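(* Let $(\mathcal{C},\mathbb{E},\mathfrak{s})$ be an extriangulated category satisfying (WIC), let $\xi$ be a proper class of $\mathbb{E}$-triangles in $\mathcal{C}$, and assume that $\mathcal{C}$ has enough $\xi$-projectives and enough $\xi$-injectives. Let $\mathfrak{E}: A\xrightarrow{x}B\xrightarrow{y}C\overset{\delta}{\dashrightarrow}$ be an $\mathbb{E}$-triangle in $\xi$ such that $A$ and $C$ have finite $\xi$-$\mathcal{G}$projective dimension. For each $N\in\mathcal{C}$ there exist morphisms $\widetilde{\partial}^n(\mathfrak{E},N):\widetilde{\xi{\rm xt}}^n_{\mathcal{P}}(A,N)\to\widetilde{\xi{\rm xt}}^{n+1}_{\mathcal{P}}(C,N)$ ($n\in\mathbb{Z}$), natural in $N$ and $\mathfrak{E}$, such that the sequence $$\cdots\to\widetilde{\xi{\rm xt}}^n_{\mathcal{P}}(C,N)\xrightarrow{\widetilde{\xi{\rm xt}}^n_{\mathcal{P}}(y,N)}\widetilde{\xi{\rm xt}}^n_{\mathcal{P}}(B,N)\xrightarrow{\widetilde{\xi{\rm xt}}^n_{\mathcal{P}}(x,N)}\widetilde{\xi{\rm xt}}^n_{\mathcal{P}}(A,N)\xrightarrow{\widetilde{\partial}^n(\mathfrak{E},N)}\widetilde{\xi{\rm xt}}^{n+1}_{\mathcal{P}}(C,N)\to\cdots$$ is exact. Moreover, for each $n\in\mathbb{Z}$, $$\widetilde{\partial}^n(\mathfrak{E},N)\circ\widetilde{\varepsilon}^n_{\mathcal{P}}(A,N)=\widetilde{\varepsilon}^{n+1}_{\mathcal{P}}(C,N)\circ\partial^n(\mathfrak{E},N)$$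 as maps $\xi{\rm xt}^n_{\xi}(A,N)\to\widetilde{\xi{\rm xt}}^{n+1}_{\mathcal{P}}(C,N)$.
   Context: Extriangulated categories (Nakaoka--Palu). $\mathcal{C}$ is an additive category with an additive bifunctor $\mathbb{E}:\mathcal{C}^{\rm op}\times\mathcal{C}\to{\rm Ab}$. Elements $\delta\in\mathbb{E}(C,A)$ are $\mathbb{E}$-extensions; for $a:A\to A'$ and $c:C'\to C$ write $a_*\delta=\mathbb{E}(C,a)(\delta)$, $c^*\delta=\mathbb{E}(c,A)(\delta)$. A morphism $\delta\to\delta'$ ($\delta\in\mathbb{E}(C,A)$, $\delta'\in\mathbb{E}(C',A')$) is a pair $(a:A\to A',c:C\to C')$ with $a_*\delta=c^*\delta'$. Sequences $A\to B\to C$ and $A\to B'\to C$ are equivalent if there is an isomorphism $B\cong B'$ compatible with the maps. $\mathfrak{s}$ assigns to each $\delta\in\mathbb{E}(C,A)$ an equivalence class $\mathfrak{s}(\delta)=[A\xrightarrow{x}B\xrightarrow{y}C]$ such that every morphism $(a,c)$ of extensions lifts to a commutative $(a,b,c)$, with $\mathfrak{s}(0)=[A\to A\oplus C\to C]$ and $\mathfrak{s}(\delta\oplus\delta')=\mathfrak{s}(\delta)\oplus\mathfrak{s}(\delta')$. Axioms: (ET3) for $\delta,\delta'$ realized by $A\xrightarrow{x}B\xrightarrow{y}C$, $A'\xrightarrow{x'}B'\xrightarrow{y'}C'$ and $a,b$ with $bx=x'a$ there is $c$ with $cy=y'b$ and $a_*\delta=c^*\delta'$; (ET4) if $\delta\in\mathbb{E}(D,A)$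 is realized by $A\xrightarrow{f}B\xrightarrow{f'}D$ and $\delta'\in\mathbb{E}(F,B)$ by $B\xrightarrow{g}C\xrightarrow{g'}F$, there are an object $E$, maps $d:D\to E$, $e:E\to F$, $h':C\to E$ and $\delta''\in\mathbb{E}(E,A)$ realized by $A\xrightarrow{gf}C\xrightarrow{h'}E$ with $h'g=df'$, $eh'=g'$, $D\xrightarrow{d}E\xrightarrow{e}F$ realizing $f'_*\delta'$, $d^*\delta''=\delta$, $f_*\delta''=e^*\delta'$; and the duals of (ET3), (ET4). If $A\xrightarrow{x}B\xrightarrow{y}C$ realizes $\delta$, then $A\xrightarrow{x}B\xrightarrow{y}C\overset{\delta}{\dashrightarrow}$ is an $\mathbb{E}$-triangle, $x$ is an inflation and $y$ a deflation. It is split if $\delta=0$. A morphism of $\mathbb{E}$-triangles is a commutative triple $(a,b,c)$ with $a_*\delta=c^*\delta'$. (WIC): if $gf$ is an inflation then so is $f$; if $gf$ is a deflation then so is $g$. Proper class. A class $\xi$ of $\mathbb{E}$-triangles closed under isomorphisms is proper if: it is closed under finite coproducts and contains all split $\mathbb{E}$-triangles; it is closed under base change ($\delta\mapsto c^*\delta$) and cobase change ($\delta\mapsto a_*\delta$); and it is saturated: for $\mathbb{E}$-triangles $A_i\xrightarrow{x_i}B_i\xrightarrow{y_i}C\overset{\delta_i}{\dashrightarrow}$ ($i=1,2$), if the $\mathbb{E}$-triangles of $\delta_2$ and of $y_2^*\delta_1$ are in $\xi$, then so is that of $\delta_1$. Relative notions. $P$ is $\xi$-projective if $0\to\mathcal{C}(P,A)\to\mathcal{C}(P,B)\to\mathcal{C}(P,C)\to0$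 is exact for every $\mathbb{E}$-triangle $A\to B\to C\dashrightarrow$ in $\xi$; $\xi$-injective is dual. $\mathcal{P}(\xi)$ is the class of $\xi$-projectives. Enough $\xi$-projectives: each $A$ admits an $\mathbb{E}$-triangle $K\to P\to A\dashrightarrow$ in $\xi$ with $P\in\mathcal{P}(\xi)$; enough $\xi$-injectives is dual. Complexes are written homologically. A complex $\mathbf{X}$ is $\xi$-exact if for each $n$ there is an $\mathbb{E}$-triangle $K_{n+1}\xrightarrow{g_n}X_n\xrightarrow{f_n}K_n\dashrightarrow$ in $\xi$ with $d_n=g_{n-1}f_n$. A complete $\xi$-projective resolution is a $\xi$-exact complex of $\xi$-projectives (indexed by $\mathbb{Z}$) whose $\mathbb{E}$-triangles $K_{n+1}\to P_n\to K_n\dashrightarrow$ can be chosen so that $0\to\mathcal{C}(K_n,W)\to\mathcal{C}(P_n,W)\to\mathcal{C}(K_{n+1},W)\to0$ is exact for all $W\in\mathcal{P}(\xi)$; the objects $K_n$ are then called $\xi$-$\mathcal{G}$projective. The $\xi$-$\mathcal{G}$projective dimension is defined inductively: it is $0$ for $\xi$-$\mathcal{G}$projectives, and $\le n$ for $A$ if there is an $\mathbb{E}$-triangle $K\to G\to A\dashrightarrow$ in $\xi$ with $G$ $\xi$-$\mathcal{G}$projective and $K$ of $\xi$-$\mathcal{G}$projective dimension $\le n-1$. Cohomology. A $\xi$-projective resolution $\pi:\mathbf{P}\to M$ is a $\xi$-exact complex $\cdots\to P_1\to P_0\to M\to0$ with $P_n\in\mathcal{P}(\xi)$; $\xi{\rm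 xt}^n_{\xi}(M,N)=H^n(\mathcal{C}(\mathbf{P},N))$ (zero for $n<0$), where $H^n$ is the cohomology at $\mathcal{C}(P_n,N)$. For $\mathfrak{E}$ in $\xi$, there are $\xi$-projective resolutions $\mathbf{P},\mathbf{P}',\mathbf{P}''$ of $A,B,C$ and a degreewise split sequence $\mathbf{P}\to\mathbf{P}'\to\mathbf{P}''$ over $A\to B\to C$ (Horseshoe Lemma), and $\partial^n(\mathfrak{E},N):\xi{\rm xt}^n_{\xi}(A,N)\to\xi{\rm xt}^{n+1}_{\xi}(C,N)$ is the connecting map of $0\to\mathcal{C}(\mathbf{P}'',N)\to\mathcal{C}(\mathbf{P}',N)\to\mathcal{C}(\mathbf{P},N)\to0$. The $\xi$-complete cohomology is $\widetilde{\xi{\rm xt}}^n_{\mathcal{P}}(M,N)=H^n\big(\mathcal{C}(\mathbf{P}_M,\mathbf{P}_N)/\overline{\mathcal{C}}(\mathbf{P}_M,\mathbf{P}_N)\big)$, where $\mathbf{P}_M,\mathbf{P}_N$ are $\xi$-projective resolutions, $\mathcal{C}(\mathbf{P}_M,\mathbf{P}_N)$ is the Hom complex, $\overline{\mathcal{C}}$ is the subcomplex of families $(\varphi_i)$ with $\varphi_i=0$ for $i\gg0$, and $H^n$ is the homology in homological degree $-n$. A $\xi$-complete resolution of $M$ is a diagram $\mathbf{T}\xrightarrow{\nu}\mathbf{P}\xrightarrow{\pi}M$ with $\pi$ a $\xi$-projective resolution, $\mathbf{T}$ a complete $\xi$-projective resolution and $\nu$ a chain map with $\nu_i={\rm id}$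 for $i\gg0$. It is known that every object $M$ of finite $\xi$-$\mathcal{G}$projective dimension admits one, and that then $\widetilde{\xi{\rm xt}}^n_{\mathcal{P}}(M,N)\cong H^n(\mathcal{C}(\mathbf{T},N))$ for all $n\in\mathbb{Z}$ and all $N$, independently of choices and functorially; the groups are identified in this way. The comparison map $\widetilde{\varepsilon}^n_{\mathcal{P}}(M,N):\xi{\rm xt}^n_{\xi}(M,N)\to\widetilde{\xi{\rm xt}}^n_{\mathcal{P}}(M,N)$ is $H^n\mathcal{C}(\nu,N):H^n\mathcal{C}(\mathbf{P},N)\to H^n\mathcal{C}(\mathbf{T},N)$. *)

(* Defs.v *)
From HB Require Import structures.
From mathcomp Require Import all_boot all_order all_algebra.
From mathcomp Require Import boolp ring zify.

Set Implicit Arguments.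
Unset Strict Implicit.
Unset Printing Implicit Defensive.

Import Order.TTheory GRing.Theory Num.Theory.
Local Open Scope ring_scope.

Definition exact_at (U V W : zmodType) (f : U -> V) (g : V -> W) : Prop :=
  forall v, g v = 0 <-> exists u, f u = v.

Definition short_exact (U V W : zmodType) (f : U -> V) (g : V -> W) : Prop :=
  [/\ injective f, exact_at f g & forall w, exists v, g v = w].

Section Subquotient.
Variables (U V W : zmodType) (f : {additive U -> V}) (g : {additive V -> W}).

Definition ker_pred : {pred V} := fun v => g v == 0.

Fact ker_pred_closed : zmod_closed ker_pred.
Proof.
split; first by rewrite unfold_in raddf0.
move=> x y; rewrite !unfold_in raddfB => /eqP-> /eqP->.
by rewrite subrr.
Qed.

HB.instance Definition _ := GRing.isZmodClosed.Build V ker_pred ker_pred_closed.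

Record kernel := Kernel { kernel_val :> V; kernelP : kernel_val \in ker_pred }.

HB.instance Definition _ := [isSub for kernel_val].
HB.instance Definition _ := [Choice of kernel by <:].
HB.instance Definition _ := [SubChoice_isSubZmodule of kernel by <:].

Definition im_pred : {pred kernel} := fun z => `[< exists u, f u = val z >].

Fact im_pred_closed : zmod_closed im_pred.
Proof.
split; first by apply/asboolP; exists 0; rewrite !raddf0.
move=> x y /asboolP[u hu] /asboolP[v hv]; apply/asboolP; exists (u - v).
by rewrite !raddfB hu hv.
Qed.

HB.instance Definition _ :=
  GRing.isZmodClosed.Build kernel im_pred im_pred_closed.

(* ker g / (im f :&: ker g), which is ker g / im f as soon as g f = 0. *)
Definition subquot : zmodType := Quotient.quot im_pred.

Definition subquot_class (z : kernel) : subquot := \pi_subquot%qT z.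

Lemma subquot_class_eq0 (z : kernel) :
  subquot_class z = 0 <-> exists u, f u = val z.
Proof.
rewrite /subquot_class -[0](raddf0 (\pi_subquot%qT : {additive kernel -> subquot})).
split; first by move/eqP; rewrite -Quotient.idealrBE subr0 => /asboolP.
by move=> h; apply/eqP; rewrite -Quotient.idealrBE subr0; apply/asboolP.
Qed.

Lemma subquot_classB : zmod_morphism subquot_class.
Proof. by move=> x y; rewrite /subquot_class raddfB. Qed.

End Subquotient.

Arguments ker_pred {V W} g.
Arguments im_pred {U V W} f g.

HB.instance Definition _ (U V W : zmodType) (f : {additive U -> V})
  (g : {additive V -> W}) :=
  GRing.isZmodMorphism.Build (kernel g) (subquot f g) (@subquot_class _ _ _ f g)
    (@subquot_classB _ _ _ f g).

Section QuotientMap.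
Variables (V W : zmodType) (I : zmodClosed V) (J : zmodClosed W).
Variables (h : {additive V -> W}) (hIJ : forall x, x \in I -> h x \in J).

Definition quot_fun (a : Quotient.quot I) : Quotient.quot J :=
  \pi_(Quotient.quot J)%qT (h (repr a)).

Fact quot_funE x :
  quot_fun (\pi_(Quotient.quot I)%qT x) = \pi_(Quotient.quot J)%qT (h x).
Proof.
apply/eqP; rewrite -Quotient.idealrBE -raddfB; apply: hIJ.
by rewrite Quotient.idealrBE reprK.
Qed.

Fact quot_funB : zmod_morphism quot_fun.
Proof.
move=> a b; rewrite -[a]reprK -[b]reprK -raddfB !quot_funE.
by rewrite !raddfB.
Qed.

Definition quot_map : {additive Quotient.quot I -> Quotient.quot J} :=
  HB.pack quot_fun
    (GRing.isZmodMorphism.Build (Quotient.quot I) (Quotient.quot J)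
       quot_fun quot_funB).

Lemma quot_mapE x :
  quot_map (\pi_(Quotient.quot I)%qT x) = \pi_(Quotient.quot J)%qT (h x).
Proof. exact: quot_funE. Qed.

End QuotientMap.

(* Differentials are indexed by all pairs of degrees and vanish unless the    *)
(* degrees are consecutive; this avoids transports along i - 1 + 1 = i.       *)
Record cocomplex := Cocomplex {
  coch :> int -> zmodType;
  cod : forall i j, {additive coch i -> coch j};
  cod_shape : forall i j x, j != i + 1 -> cod i j x = 0;
  cod_cod : forall i j k x, cod j k (cod i j x) = 0 }.

Definition cohomology (K : cocomplex) (n : int) : zmodType :=
  subquot (cod K (n - 1) n) (cod K n (n + 1)).

Definition cocycle (K : cocomplex) (n : int) : zmodType :=
  kernel (cod K n (n + 1)).

Definition coclass (K : cocomplex) (n : int) (z : cocycle K n) :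
  cohomology K n := subquot_class (cod K (n - 1) n) z.

Record cocomplex_map (K L : cocomplex) := CocomplexMap {
  comap :> forall n, {additive K n -> L n};
  comapC : forall i j x, comap j (cod K i j x) = cod L i j (comap i x) }.

Section CohomologyMap.
Variables (K L : cocomplex) (u : cocomplex_map K L) (n : int).

Fact cocycle_map_subproof (z : cocycle K n) :
  u n (val z) \in ker_pred (cod L n (n + 1)).
Proof.
case: z => z /= hz; rewrite unfold_in -comapC.
by move: hz; rewrite unfold_in => /eqP->; rewrite raddf0.
Qed.

Definition cocycle_map (z : cocycle K n) : cocycle L n :=
  Kernel (cocycle_map_subproof z).

Fact cocycle_mapB : zmod_morphism cocycle_map.
Proof. by move=> x y; apply: val_inj; rewrite /= !raddfB. Qed.

HB.instance Definition _ :=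
  GRing.isZmodMorphism.Build (cocycle K n) (cocycle L n)
    cocycle_map cocycle_mapB.

Fact cocycle_map_im z : z \in im_pred (cod K (n - 1) n) (cod K n (n + 1)) ->
  cocycle_map z \in im_pred (cod L (n - 1) n) (cod L n (n + 1)).
Proof.
move=> /asboolP[w hw]; apply/asboolP; exists (u _ w).
by rewrite -comapC hw.
Qed.

Definition cohomology_map : {additive cohomology K n -> cohomology L n} :=
  quot_map cocycle_map_im.

Lemma cohomology_mapE z :
  cohomology_map (coclass z) = coclass (cocycle_map z).
Proof. exact: (quot_mapE cocycle_map_im). Qed.

End CohomologyMap.

Section QuotientComplex.
Variables (K : cocomplex) (S : forall n, zmodClosed (K n)).
Variable S_cod : forall i j x, x \in S i -> cod K i j x \in S j.

Definition quot_cod i j :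
  {additive Quotient.quot (S i) -> Quotient.quot (S j)} :=
  quot_map (@S_cod i j).

Fact quot_cod_shape i j x : j != i + 1 -> quot_cod i j x = 0.
Proof.
move=> hij; rewrite -[x]reprK quot_mapE (cod_shape _ hij).
exact: raddf0.
Qed.

Fact quot_cod_cod i j k x : quot_cod j k (quot_cod i j x) = 0.
Proof.
rewrite -[x]reprK !quot_mapE cod_cod.
exact: raddf0.
Qed.

Definition quot_cocomplex : cocomplex :=
  @Cocomplex (fun n => Quotient.quot (S n)) quot_cod quot_cod_shape quot_cod_cod.

Fact quot_cocomplex_proj_comm i j (x : K i) :
  \pi_(Quotient.quot (S j))%qT (cod K i j x) =
  quot_cod i j (\pi_(Quotient.quot (S i))%qT x).
Proof. by rewrite quot_mapE. Qed.

Definition quot_cocomplex_proj : cocomplex_map K quot_cocomplex :=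
  @CocomplexMap K quot_cocomplex (fun n => \pi_(Quotient.quot (S n))%qT)
    quot_cocomplex_proj_comm.

End QuotientComplex.

Section QuotientComplexMap.
Variables (K L : cocomplex) (u : cocomplex_map K L).
Variables (S : forall n, zmodClosed (K n)) (T : forall n, zmodClosed (L n)).
Variable S_cod : forall i j x, x \in S i -> cod K i j x \in S j.
Variable T_cod : forall i j x, x \in T i -> cod L i j x \in T j.
Variable u_S : forall n x, x \in S n -> u n x \in T n.

Fact quot_cocomplex_map_comm i j (x : quot_cocomplex S_cod i) :
  quot_map (@u_S j) (cod (quot_cocomplex S_cod) i j x) =
  cod (quot_cocomplex T_cod) i j (quot_map (@u_S i) x).
Proof.
change (quot_map (@u_S j) (quot_map (@S_cod i j) x) =
        quot_map (@T_cod i j) (quot_map (@u_S i) x)).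
by rewrite -[x]reprK !quot_mapE comapC.
Qed.

Definition quot_cocomplex_map :
  cocomplex_map (quot_cocomplex S_cod) (quot_cocomplex T_cod) :=
  @CocomplexMap (quot_cocomplex S_cod) (quot_cocomplex T_cod)
    (fun n => quot_map (@u_S n)) quot_cocomplex_map_comm.

End QuotientComplexMap.

Section Connecting.
Variables (K' K K'' : cocomplex).
Variables (u : cocomplex_map K' K) (v : cocomplex_map K K'').
Hypothesis uv_exact : forall n, short_exact (u n) (v n).
Variable n : int.

Definition connecting_rel (a : cohomology K'' n) (b : cohomology K' (n + 1)) :=
  exists (z : cocycle K'' n) (w : K n) (z' : cocycle K' (n + 1)),
    [/\ coclass z = a, v n w = val z,
        u (n + 1) (val z') = cod K n (n + 1) w & coclass z' = b].

Fact cocycleP (L : cocomplex) m (z : cocycle L m) : cod L m (m + 1) (val z) = 0.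
Proof. by case: z => z /=; rewrite unfold_in => /eqP. Qed.

Lemma connecting_total a : exists b, connecting_rel a b.
Proof.
have [u_inj u_ex _] := uv_exact (n + 1); have [_ _ v_surj] := uv_exact n.
pose z : cocycle K'' n := repr a.
have ha : coclass z = a by apply: reprK.
have [w hw] := v_surj (val z).
have [x hx] : exists x, u (n + 1) x = cod K n (n + 1) w.
  by apply/u_ex; rewrite comapC hw cocycleP.
have hz : x \in ker_pred (cod K' (n + 1) (n + 1 + 1)).
  have [inj2 _ _] := uv_exact (n + 1 + 1).
  by rewrite unfold_in; apply/eqP/inj2; rewrite comapC hx cod_cod raddf0.
by exists (coclass (Kernel hz)), z, w, (Kernel hz).
Qed.

Lemma coclass_eq (L : cocomplex) m (z z' : cocycle L m) :
  coclass z = coclass z' <-> exists y, cod L (m - 1) m y = val z - val z'.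
Proof.
rewrite -[val z - _](raddfB val) -subquot_class_eq0 subquot_classB /coclass.
by split=> [->|/eqP]; rewrite ?subrr // subr_eq0 => /eqP.
Qed.

Lemma connecting_functional a b b' :
  connecting_rel a b -> connecting_rel a b' -> b = b'.
Proof.
move=> [z1 [w1 [x1 [<- hw1 hx1 <-]]]] [z2 [w2 [x2 [/esym h hw2 hx2 <-]]]].
have [y hy] := (coclass_eq _ _).1 h.
have [_ _ /(_ y)[y' hy']] := uv_exact (n - 1).
have [_ u_ex _] := uv_exact n; have [u_inj _ _] := uv_exact (n + 1).
have [t ht] : exists t, u n t = w1 - w2 - cod K (n - 1) n y'.
  by apply/u_ex; rewrite !raddfB comapC hy' hy hw1 hw2 subrr.
apply/coclass_eq; suff: cod K' n (n + 1) t = val x1 - val x2.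
  by move=> <-; rewrite [n + 1 - 1]addrK; exists t.
apply: u_inj; rewrite comapC ht !raddfB cod_cod subr0.
by rewrite hx1 hx2.
Qed.

Definition connecting (a : cohomology K'' n) : cohomology K' (n + 1) :=
  projT1 (cid (connecting_total a)).

End Connecting.

Record additive_category := AdditiveCategory {
  ob :> Type;
  mor : ob -> ob -> zmodType;
  idm : forall A, mor A A;
  comp : forall A B C, mor B C -> mor A B -> mor A C;
  comp1m : forall A B (f : mor A B), comp (idm B) f = f;
  compm1 : forall A B (f : mor A B), comp f (idm A) = f;
  compA : forall A B C D (h : mor C D) (g : mor B C) (f : mor A B),
    comp h (comp g f) = comp (comp h g) f;
  compDl : forall A B C (g g' : mor B C) (f : mor A B),
    comp (g + g') f = comp g f + comp g' f;
  compDr : forall A B C (g : mor B C) (f f' : mor A B),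
    comp g (f + f') = comp g f + comp g f';
  zob : ob;
  zob_id : idm zob = 0;
  bip : ob -> ob -> ob;
  in1 : forall A B, mor A (bip A B);
  in2 : forall A B, mor B (bip A B);
  pr1 : forall A B, mor (bip A B) A;
  pr2 : forall A B, mor (bip A B) B;
  pr1_in1 : forall A B, comp (pr1 A B) (in1 A B) = idm A;
  pr2_in2 : forall A B, comp (pr2 A B) (in2 A B) = idm B;
  pr1_in2 : forall A B, comp (pr1 A B) (in2 A B) = 0;
  pr2_in1 : forall A B, comp (pr2 A B) (in1 A B) = 0;
  bip_id : forall A B,
    comp (in1 A B) (pr1 A B) + comp (in2 A B) (pr2 A B) = idm (bip A B) }.

Arguments idm {a} A.
Arguments in1 {a} A B.
Arguments in2 {a} A B.
Arguments pr1 {a} A B.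
Arguments pr2 {a} A B.

Notation "g \oc f" := (comp g f) (at level 40, left associativity).

Section CategoryTheory.
Variable C : additive_category.
Implicit Types A B : C.

Definition is_iso A B (f : mor A B) : Prop :=
  exists g : mor B A, g \oc f = idm A /\ f \oc g = idm B.

Definition hom_sum A B A' B' (f : mor A B) (f' : mor A' B') :
  mor (bip A A') (bip B B') :=
  in1 B B' \oc f \oc pr1 A A' + in2 B B' \oc f' \oc pr2 A A'.

Definition precomp N A B (f : mor A B) (h : mor B N) : mor A N := h \oc f.
Definition postcomp N A B (f : mor A B) (h : mor N A) : mor N B := f \oc h.

Fact precompB N A B (f : mor A B) : zmod_morphism (@precomp N A B f).
Proof.
move=> x y; rewrite /precomp; apply/esym/eqP; rewrite subr_eq -compDl.
by rewrite addrNK.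
Qed.

Fact postcompB N A B (f : mor A B) : zmod_morphism (@postcomp N A B f).
Proof.
move=> x y; rewrite /postcomp; apply/esym/eqP; rewrite subr_eq -compDr.
by rewrite addrNK.
Qed.

HB.instance Definition _ N A B (f : mor A B) :=
  GRing.isZmodMorphism.Build (mor B N) (mor A N) (@precomp N A B f)
    (@precompB N A B f).

HB.instance Definition _ N A B (f : mor A B) :=
  GRing.isZmodMorphism.Build (mor N A) (mor N B) (@postcomp N A B f)
    (@postcompB N A B f).

Lemma comp0m A B N (f : mor A B) : (0 : mor B N) \oc f = 0.
Proof. exact: (raddf0 (@precomp N A B f)). Qed.
Lemma compm0 A B N (f : mor A B) : f \oc (0 : mor N A) = 0.
Proof. exact: (raddf0 (@postcomp N A B f)). Qed.
Lemma compBl A B N (g h : mor B N) (f : mor A B) :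
  (g - h) \oc f = g \oc f - h \oc f.
Proof. exact: (raddfB (@precomp N A B f)). Qed.
Lemma compBr A B N (g h : mor N A) (f : mor A B) :
  f \oc (g - h) = f \oc g - f \oc h.
Proof. exact: (raddfB (@postcomp N A B f)). Qed.
Lemma compZl A B N (g : mor B N) (f : mor A B) (m : int) :
  (g *~ m) \oc f = (g \oc f) *~ m.
Proof. exact: (raddfMz (@precomp N A B f)). Qed.
Lemma compZr A B N (g : mor N A) (f : mor A B) (m : int) :
  f \oc (g *~ m) = (f \oc g) *~ m.
Proof. exact: (raddfMz (@postcomp N A B f)). Qed.

(* is_id f forces the source and the target of f to be the same object.        *)
Inductive is_id A : forall B, mor A B -> Prop := IsId : is_id (idm A).

(* Homological indexing: diff i j : X_i -> X_j vanishes unless j = i - 1.      *)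
Record complex := Complex {
  cob :> int -> C;
  diff : forall i j, mor (cob i) (cob j);
  d_shape : forall i j, i != j + 1 -> diff i j = 0;
  d_d : forall i j k, diff j k \oc diff i j = 0 }.

Record chain_map (X Y : complex) := ChainMap {
  chmap :> forall i, mor (X i) (Y i);
  chmapC : forall i j, chmap j \oc diff X i j = diff Y i j \oc chmap i }.

(* C(X, N) carries the differentials f |-> f d, without signs.                 *)
Section HomTo.
Variables (X : complex) (N : C).

Fact homto_shape (i j : int) (x : mor (X i) N) :
  j != i + 1 -> precomp (diff X j i) x = 0.
Proof. by move=> h; rewrite /precomp d_shape ?compm0. Qed.

Fact homto_cod_cod i j k (x : mor (X i) N) :
  precomp (diff X k j) (precomp (diff X j i) x) = 0.
Proof. by rewrite /precomp -compA d_d compm0. Qed.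

Definition homto : cocomplex :=
  @Cocomplex (fun n => mor (X n) N) (fun i j => precomp (diff X j i))
    homto_shape homto_cod_cod.

End HomTo.

Section HomToMap.
Variables (X Y : complex) (u : chain_map X Y) (N : C).

Fact homto_map_comm i j (x : homto Y N i) :
  precomp (u j) (cod (homto Y N) i j x) =
  cod (homto X N) i j (precomp (u i) x).
Proof. by rewrite /= /precomp -!compA chmapC. Qed.

Definition homto_map : cocomplex_map (homto Y N) (homto X N) :=
  @CocomplexMap (homto Y N) (homto X N) (fun n => precomp (u n))
    homto_map_comm.

End HomToMap.

End CategoryTheory.

Arguments IsId {C} A.

Record ext_bifunctor (C : additive_category) := ExtBifunctor {
  ext :> C -> C -> zmodType;
  push : forall X A A', mor A A' -> ext X A -> ext X A';
  pull : forall X X' A, mor X' X -> ext X A -> ext X' A;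
  pushDr : forall X A A' (a : mor A A') (e e' : ext X A),
    push a (e + e') = push a e + push a e';
  pullDr : forall X X' A (c : mor X' X) (e e' : ext X A),
    pull c (e + e') = pull c e + pull c e';
  pushDl : forall X A A' (a a' : mor A A') (e : ext X A),
    push (a + a') e = push a e + push a' e;
  pullDl : forall X X' A (c c' : mor X' X) (e : ext X A),
    pull (c + c') e = pull c e + pull c' e;
  push1 : forall X A (e : ext X A), push (idm A) e = e;
  pull1 : forall X A (e : ext X A), pull (idm X) e = e;
  push_comp : forall X A A' A'' (a' : mor A' A'') (a : mor A A') (e : ext X A),
    push (a' \oc a) e = push a' (push a e);
  pull_comp : forall X X' X'' A (c : mor X' X) (c' : mor X'' X') (e : ext X A),
    pull (c \oc c') e = pull c' (pull c e);
  push_pull : forall X X' A A' (a : mor A A') (c : mor X' X) (e : ext X A),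
    push a (pull c e) = pull c (push a e) }.

Definition equiv_seq (C : additive_category) (A B B' X : C)
    (x : mor A B) (y : mor B X) (x' : mor A B') (y' : mor B' X) : Prop :=
  exists b : mor B B', [/\ is_iso b, b \oc x = x' & y' \oc b = y].

Definition ext_sum (C : additive_category) (E : ext_bifunctor C) (A A' X X' : C)
    (e : E X A) (e' : E X' A') : E (bip X X') (bip A A') :=
  push (in1 A A') (pull (pr1 X X') e) + push (in2 A A') (pull (pr2 X X') e').

(* realizes x y e : the sequence (x, y) belongs to the class s(e).             *)
Record extriangulated := Extriangulated {
  exC :> additive_category;
  exE : ext_bifunctor exC;
  realizes : forall A B X : exC, mor A B -> mor B X -> exE X A -> Prop;
  realizes_total : forall (A X : exC) (e : exE X A),
    exists (B : exC) (x : mor A B) (y : mor B X), realizes x y e;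
  realizes_equiv : forall (A B B' X : exC) (x : mor A B) (y : mor B X)
      (x' : mor A B') (y' : mor B' X) (e : exE X A),
    realizes x y e -> (realizes x' y' e <-> equiv_seq x y x' y');
  realizes_lift : forall (A B X A' B' X' : exC) (x : mor A B) (y : mor B X)
      (e : exE X A) (x' : mor A' B') (y' : mor B' X') (e' : exE X' A')
      (a : mor A A') (c : mor X X'),
    realizes x y e -> realizes x' y' e' -> push a e = pull c e' ->
    exists b : mor B B', b \oc x = x' \oc a /\ c \oc y = y' \oc b;
  realizes0 : forall A X : exC, realizes (in1 A X) (pr2 A X) 0;
  realizes_sum : forall (A B X A' B' X' : exC) (x : mor A B) (y : mor B X)
      (e : exE X A) (x' : mor A' B') (y' : mor B' X') (e' : exE X' A'),
    realizes x y e -> realizes x' y' e' ->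
    realizes (hom_sum x x') (hom_sum y y') (ext_sum e e');
  ET3 : forall (A B X A' B' X' : exC) (x : mor A B) (y : mor B X)
      (e : exE X A) (x' : mor A' B') (y' : mor B' X') (e' : exE X' A')
      (a : mor A A') (b : mor B B'),
    realizes x y e -> realizes x' y' e' -> b \oc x = x' \oc a ->
    exists c : mor X X', c \oc y = y' \oc b /\ push a e = pull c e';
  ET3_op : forall (A B X A' B' X' : exC) (x : mor A B) (y : mor B X)
      (e : exE X A) (x' : mor A' B') (y' : mor B' X') (e' : exE X' A')
      (b : mor B B') (c : mor X X'),
    realizes x y e -> realizes x' y' e' -> c \oc y = y' \oc b ->
    exists a : mor A A', b \oc x = x' \oc a /\ push a e = pull c e';
  ET4 : forall (A B D G F : exC) (f : mor A B) (f' : mor B D) (e : exE D A)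
      (g : mor B G) (g' : mor G F) (e' : exE F B),
    realizes f f' e -> realizes g g' e' ->
    exists (H : exC) (u : mor D H) (v : mor H F) (h' : mor G H) (e'' : exE H A),
      [/\ realizes (g \oc f) h' e'', realizes u v (push f' e'),
          h' \oc g = u \oc f' /\ v \oc h' = g',
          pull u e'' = e & push f e'' = pull v e'];
  ET4_op : forall (A B D G F : exC) (f' : mor D B) (f : mor B A) (e : exE A D)
      (g' : mor F G) (g : mor G B) (e' : exE B F),
    realizes f' f e -> realizes g' g e' ->
    exists (H : exC) (u : mor H D) (v : mor F H) (h' : mor H G) (e'' : exE A H),
      [/\ realizes h' (f \oc g) e'', realizes v u (pull f' e'),
          g \oc h' = f' \oc u /\ h' \oc v = g',
          push u e'' = e & pull f e'' = push v e'] }.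

Section RelativeHomology.
Variable C : extriangulated.
Implicit Types A B M N P X Y Z : C.

Definition inflation A B (x : mor A B) : Prop :=
  exists X (y : mor B X) (e : exE C X A), realizes x y e.

Definition deflation B X (y : mor B X) : Prop :=
  exists A (x : mor A B) (e : exE C X A), realizes x y e.

Definition WIC : Prop :=
  (forall A B X (f : mor A B) (g : mor B X), inflation (g \oc f) -> inflation f)
  /\
  (forall A B X (f : mor A B) (g : mor B X), deflation (g \oc f) -> deflation g).

Definition triangle_morphism A B X A' B' X'
    (x : mor A B) (y : mor B X) (e : exE C X A)
    (x' : mor A' B') (y' : mor B' X') (e' : exE C X' A')
    (a : mor A A') (b : mor B B') (c : mor X X') : Prop :=
  [/\ b \oc x = x' \oc a, c \oc y = y' \oc b & push a e = pull c e'].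

Definition triangle_class :=
  forall A B X, mor A B -> mor B X -> exE C X A -> Prop.

(* The empty coproduct is split, hence covered by pc_split.                    *)
Record proper_class (xi : triangle_class) : Prop := ProperClass {
  pc_realizes : forall A B X (x : mor A B) (y : mor B X) (e : exE C X A),
    xi _ _ _ x y e -> realizes x y e;
  pc_iso : forall A B X A' B' X' (x : mor A B) (y : mor B X) (e : exE C X A)
      (x' : mor A' B') (y' : mor B' X') (e' : exE C X' A')
      (a : mor A A') (b : mor B B') (c : mor X X'),
    xi _ _ _ x y e -> realizes x' y' e' ->
    triangle_morphism x y e x' y' e' a b c ->
    is_iso a -> is_iso b -> is_iso c -> xi _ _ _ x' y' e';
  pc_sum : forall A B X A' B' X' (x : mor A B) (y : mor B X) (e : exE C X A)
      (x' : mor A' B') (y' : mor B' X') (e' : exE C X' A'),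
    xi _ _ _ x y e -> xi _ _ _ x' y' e' ->
    xi _ _ _ (hom_sum x x') (hom_sum y y') (ext_sum e e');
  pc_split : forall A B X (x : mor A B) (y : mor B X),
    realizes x y (0 : exE C X A) -> xi _ _ _ x y (0 : exE C X A);
  pc_base : forall A B X B' X' (x : mor A B) (y : mor B X) (e : exE C X A)
      (c : mor X' X) (x' : mor A B') (y' : mor B' X'),
    xi _ _ _ x y e -> realizes x' y' (pull c e) -> xi _ _ _ x' y' (pull c e);
  pc_cobase : forall A B X A' B' (x : mor A B) (y : mor B X) (e : exE C X A)
      (a : mor A A') (x' : mor A' B') (y' : mor B' X),
    xi _ _ _ x y e -> realizes x' y' (push a e) -> xi _ _ _ x' y' (push a e);
  pc_saturated : forall A1 B1 A2 B2 B3 X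
      (x1 : mor A1 B1) (y1 : mor B1 X) (e1 : exE C X A1)
      (x2 : mor A2 B2) (y2 : mor B2 X) (e2 : exE C X A2)
      (x3 : mor A1 B3) (y3 : mor B3 B2),
    realizes x1 y1 e1 -> xi _ _ _ x2 y2 e2 -> xi _ _ _ x3 y3 (pull y2 e1) ->
    xi _ _ _ x1 y1 e1 }.

Variable xi : triangle_class.

Definition projective P : Prop :=
  forall A B X (x : mor A B) (y : mor B X) (e : exE C X A), xi x y e ->
    short_exact (postcomp (N := P) x) (postcomp (N := P) y).

Definition injective_obj N : Prop :=
  forall A B X (x : mor A B) (y : mor B X) (e : exE C X A), xi x y e ->
    short_exact (precomp (N := N) y) (precomp (N := N) x).

Definition enough_projectives : Prop :=
  forall A, exists K P (x : mor K P) (y : mor P A) (e : exE C A K),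
    xi x y e /\ projective P.

Definition enough_injectives : Prop :=
  forall A, exists I K (x : mor A I) (y : mor I K) (e : exE C K A),
    xi x y e /\ injective_obj I.

Definition complete_resolution_via (T : complex C) (K : int -> C) : Prop :=
  (forall n, projective (T n)) /\
  exists (g : forall n, mor (K (n + 1)) (T n)) (f : forall n, mor (T n) (K n))
    (e : forall n, exE C (K n) (K (n + 1))),
    [/\ forall n, xi (g n) (f n) (e n),
        forall n, diff T (n + 1) n = g n \oc f (n + 1) &
        forall W n, projective W ->
          short_exact (precomp (N := W) (f n)) (precomp (N := W) (g n))].

Definition is_complete_resolution (T : complex C) : Prop :=
  exists K, complete_resolution_via T K.

Definition Gprojective M : Prop :=
  exists T K n, complete_resolution_via T K /\ K n = M.

Inductive Gpdim_le : nat -> C -> Prop :=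
| Gpdim_le0 M : Gprojective M -> Gpdim_le 0 M
| Gpdim_leS n K G M (x : mor K G) (y : mor G M) (e : exE C M K) :
    xi x y e -> Gprojective G -> Gpdim_le n K -> Gpdim_le n.+1 M.

Definition finite_Gpdim M : Prop := exists n, Gpdim_le n M.

(* A xi-projective resolution of M, as a complex concentrated in degrees >= 0; *)
(* syz n is the (n+1)-st syzygy, so that the E-triangles in xi are             *)
(* syz 0 -> P_0 -> M and syz n.+1 -> P_n.+1 -> syz n.                          *)
Definition syzygy M (syz : nat -> C) (n : nat) : C :=
  if n is m.+1 then syz m else M.

Definition is_resolution (P : complex C) M (aug : mor (P 0) M) : Prop :=
  [/\ forall n : int, n < 0 -> idm (P n) = 0,
      forall n : nat, projective (P n) &
      exists (syz : nat -> C)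
        (g : forall n : nat, mor (syzygy M syz n.+1) (P n))
        (f : forall n : nat, mor (P n) (syzygy M syz n))
        (e : forall n : nat, exE C (syzygy M syz n) (syzygy M syz n.+1)),
        [/\ forall n, xi (g n) (f n) (e n),
            forall n : nat, diff P n.+1 n = g n \oc f n.+1 &
            f 0%N = aug]].

Record resolution M := Resolution {
  res_cplx :> complex C;
  aug : mor (res_cplx 0) M;
  resP : is_resolution aug }.

End RelativeHomology.

Definition bifamily (V : int -> int -> zmodType) := forall i j, V i j.

Section Bifamily.
Variable V : int -> int -> zmodType.

HB.instance Definition _ := gen_eqMixin (bifamily V).
HB.instance Definition _ := gen_choiceMixin (bifamily V).

Lemma bifamilyP (f g : bifamily V) : (forall i j, f i j = g i j) -> f = g.
Proof.
move=> h; apply: functional_extensionality_dep => i.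
exact: functional_extensionality_dep.
Qed.

Fact bifamily_addA : associative (fun (f g : bifamily V) i j => f i j + g i j).
Proof. by move=> f g h; apply: bifamilyP => i j; rewrite addrA. Qed.
Fact bifamily_addC : commutative (fun (f g : bifamily V) i j => f i j + g i j).
Proof. by move=> f g; apply: bifamilyP => i j; rewrite addrC. Qed.
Fact bifamily_add0 :
  left_id (fun _ _ => 0) (fun (f g : bifamily V) i j => f i j + g i j).
Proof. by move=> f; apply: bifamilyP => i j; rewrite add0r. Qed.
Fact bifamily_addN :
  left_inverse (fun _ _ => 0) (fun (f : bifamily V) i j => - f i j)
    (fun (f g : bifamily V) i j => f i j + g i j).
Proof. by move=> f; apply: bifamilyP => i j; rewrite addNr. Qed.

HB.instance Definition _ := GRing.isZmodule.Build (bifamily V)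
  bifamily_addA bifamily_addC bifamily_add0 bifamily_addN.

Lemma bifamilyBE (f g : bifamily V) i j : (f - g) i j = f i j - g i j.
Proof. by []. Qed.

End Bifamily.

Section HomComplex.
Variables (C : additive_category) (X Y : complex C).

(* Elements of cohomological degree n of C(X, Y), i.e. families               *)
(* X_i -> Y_{i - n}, extended by zero to all pairs (i, j).                     *)
Definition degree_pred (n : int) : {pred bifamily (fun i j => mor (X i) (Y j))} :=
  fun p => `[< forall i j, i != j + n -> p i j = 0 >].

Fact degree_pred_closed n : zmod_closed (degree_pred n).
Proof.
split; first by apply/asboolP.
move=> x y /asboolP hx /asboolP hy; apply/asboolP => i j h.
by rewrite bifamilyBE hx // hy // subrr.
Qed.

HB.instance Definition _ n :=
  GRing.isZmodClosed.Build _ (degree_pred n) (degree_pred_closed n).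

Record cochain (n : int) := Cochain {
  cochain_val : bifamily (fun i j => mor (X i) (Y j));
  cochainP : cochain_val \in degree_pred n }.

HB.instance Definition _ n := [isSub for @cochain_val n].
HB.instance Definition _ n := [Choice of cochain n by <:].
HB.instance Definition _ n := [SubChoice_isSubZmodule of cochain n by <:].

Lemma cochain_shape n (p : cochain n) i j :
  i != j + n -> cochain_val p i j = 0.
Proof. move: i j; exact/asboolP/(cochainP p). Qed.

Lemma cochain_ext n (p q : cochain n) :
  (forall i j, i = j + n -> cochain_val p i j = cochain_val q i j) -> p = q.
Proof.
move=> h; apply: val_inj; apply: bifamilyP => i j.
by case: (i =P j + n) => [/h //|/eqP e]; rewrite /= !cochain_shape.
Qed.

Lemma cochainBE n (p q : cochain n) i j :
  cochain_val (p - q) i j = cochain_val p i j - cochain_val q i j.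
Proof. by []. Qed.

Lemma cochain0E n i j : cochain_val (0 : cochain n) i j = 0.
Proof. by []. Qed.

(* p -> d p - (-1)^|p| p d, the homological degree |p| being -n.               *)
Definition hom_cod_val n m (p : cochain n) :
    bifamily (fun i j => mor (X i) (Y j)) := fun i j =>
  if (m == n + 1) && (i == j + m) then
    diff Y (j + 1) j \oc cochain_val p i (j + 1)
    - (cochain_val p (i - 1) j \oc diff X i (i - 1)) *~ ((-1) ^ n)
  else 0.

Fact hom_cod_subproof n m (p : cochain n) :
  hom_cod_val m p \in degree_pred m.
Proof.
apply/asboolP => i j /negbTE h.
by rewrite /hom_cod_val h andbF.
Qed.

Definition hom_cod_fun n m (p : cochain n) : cochain m :=
  Cochain (hom_cod_subproof m p).

Fact hom_cod_funB n m : zmod_morphism (@hom_cod_fun n m).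
Proof.
move=> p q; apply: val_inj; apply: bifamilyP => i j.
rewrite [RHS]bifamilyBE /= /hom_cod_val; case: ifP => _; last by rewrite subrr.
rewrite !cochainBE compBr compBl mulrzBl !opprD !opprK.
by rewrite -!addrA; congr (_ + _); rewrite addrCA.
Qed.

HB.instance Definition _ n m :=
  GRing.isZmodMorphism.Build (cochain n) (cochain m) (@hom_cod_fun n m)
    (@hom_cod_funB n m).

Fact hom_cod_shape n m (p : cochain n) : m != n + 1 -> hom_cod_fun m p = 0.
Proof.
move=> /negbTE h; apply: cochain_ext => i j _.
by rewrite /= /hom_cod_val h.
Qed.

Fact hom_cod_cod n m k (p : cochain n) : hom_cod_fun k (hom_cod_fun m p) = 0.
Proof.
apply: cochain_ext => i j hij; rewrite cochain0E /= {1}/hom_cod_val /=.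
case: ifP => // /andP[/eqP hk _]; rewrite /hom_cod_val.
case: (m =P n + 1) => [hm|_] /=; last first.
  by rewrite compm0 comp0m mul0rz subr0.
have -> : i == j + 1 + m by rewrite hij hk; apply/eqP; ring.
have -> : i - 1 == j + m by rewrite hij hk; apply/eqP; ring.
rewrite compBr compA d_d comp0m sub0r compBl compZl compZr -!compA d_d compm0.
rewrite mul0rz subr0 hm exprzDr ?unitrN1 // expr1z mulrN1 mulrNz opprK.
by rewrite addNr.
Qed.

End HomComplex.

Arguments degree_pred {C} X Y n.

Section HomComplexFunctor.
Variable C : additive_category.
Implicit Types X Y Z : complex C.

Definition hom_cocomplex X Y : cocomplex :=
  @Cocomplex (fun n => cochain X Y n) (fun n m => @hom_cod_fun C X Y n m)
    (@hom_cod_shape C X Y) (@hom_cod_cod C X Y).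

Section Precomp.
Variables (X' X Y : complex C) (u : chain_map X' X).

Fact hom_precomp_subproof n (p : cochain X Y n) :
  (fun i j => cochain_val p i j \oc u i) \in degree_pred X' Y n.
Proof. by apply/asboolP => i j h; rewrite cochain_shape // comp0m. Qed.

Definition hom_precomp_fun n (p : cochain X Y n) : cochain X' Y n :=
  Cochain (hom_precomp_subproof p).

Fact hom_precomp_funB n : zmod_morphism (@hom_precomp_fun n).
Proof.
by move=> p q; apply: cochain_ext => i j _; rewrite cochainBE /= -compBl.
Qed.

HB.instance Definition _ n := GRing.isZmodMorphism.Build
  (cochain X Y n) (cochain X' Y n) (@hom_precomp_fun n) (@hom_precomp_funB n).

Fact hom_precomp_comm n m (p : cochain X Y n) :
  hom_precomp_fun (hom_cod_fun m p) = hom_cod_fun m (hom_precomp_fun p).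
Proof.
apply: cochain_ext => i j _; rewrite /= /hom_cod_val; case: ifP => _ /=.
  by rewrite compBl compZl -!compA chmapC.
by rewrite comp0m.
Qed.

Definition hom_precomp : cocomplex_map (hom_cocomplex X Y) (hom_cocomplex X' Y) :=
  @CocomplexMap (hom_cocomplex X Y) (hom_cocomplex X' Y)
    (fun n => @hom_precomp_fun n) hom_precomp_comm.

End Precomp.

Section Postcomp.
Variables (X Y Y' : complex C) (u : chain_map Y Y').

Fact hom_postcomp_subproof n (p : cochain X Y n) :
  (fun i j => u j \oc cochain_val p i j) \in degree_pred X Y' n.
Proof. by apply/asboolP => i j h; rewrite cochain_shape // compm0. Qed.

Definition hom_postcomp_fun n (p : cochain X Y n) : cochain X Y' n :=
  Cochain (hom_postcomp_subproof p).

Fact hom_postcomp_funB n : zmod_morphism (@hom_postcomp_fun n).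
Proof.
by move=> p q; apply: cochain_ext => i j _; rewrite cochainBE /= -compBr.
Qed.

HB.instance Definition _ n := GRing.isZmodMorphism.Build
  (cochain X Y n) (cochain X Y' n) (@hom_postcomp_fun n) (@hom_postcomp_funB n).

Fact hom_postcomp_comm n m (p : cochain X Y n) :
  hom_postcomp_fun (hom_cod_fun m p) = hom_cod_fun m (hom_postcomp_fun p).
Proof.
apply: cochain_ext => i j _; rewrite /= /hom_cod_val; case: ifP => _ /=.
  by rewrite compBr compZr !compA chmapC.
by rewrite compm0.
Qed.

Definition hom_postcomp : cocomplex_map (hom_cocomplex X Y) (hom_cocomplex X Y') :=
  @CocomplexMap (hom_cocomplex X Y) (hom_cocomplex X Y')
    (fun n => @hom_postcomp_fun n) hom_postcomp_comm.

End Postcomp.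

Section Bounded.
Variables X Y : complex C.

Definition bounded_pred n : {pred cochain X Y n} :=
  fun p => `[< exists m : int, forall i j, m <= i -> cochain_val p i j = 0 >].

Fact bounded_pred_closed n : zmod_closed (@bounded_pred n).
Proof.
split; first by apply/asboolP; exists 0.
move=> p q /asboolP[a ha] /asboolP[b hb]; apply/asboolP.
exists (Num.max a b) => i j; rewrite ge_max => /andP[hi hi'].
by rewrite cochainBE ha // hb // subrr.
Qed.

HB.instance Definition _ n :=
  GRing.isZmodClosed.Build _ (@bounded_pred n) (@bounded_pred_closed n).

Definition bounded n : zmodClosed (hom_cocomplex X Y n) := @bounded_pred n.

Fact bounded_cod n m (p : hom_cocomplex X Y n) :
  p \in bounded n -> cod (hom_cocomplex X Y) n m p \in bounded m.
Proof.
move=> /asboolP[a ha]; apply/asboolP; exists (a + 1) => i j hi.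
rewrite /= /hom_cod_val; case: ifP => // _.
rewrite ha ?ha ?compm0 ?comp0m ?mul0rz ?subr0 //; lia.
Qed.

Definition stable_hom : cocomplex := quot_cocomplex bounded_cod.

Definition stable_proj : cocomplex_map (hom_cocomplex X Y) stable_hom :=
  quot_cocomplex_proj bounded_cod.

End Bounded.

Section StableFunctor.
Variables (X' X Y Y' : complex C).

Fact bounded_precomp (u : chain_map X' X) n (p : hom_cocomplex X Y n) :
  p \in bounded X Y n -> hom_precomp Y u n p \in bounded X' Y n.
Proof.
move=> /asboolP[a ha]; apply/asboolP; exists a => i j hi.
by rewrite /= ha // comp0m.
Qed.

Fact bounded_postcomp (u : chain_map Y Y') n (p : hom_cocomplex X Y n) :
  p \in bounded X Y n -> hom_postcomp X u n p \in bounded X Y' n.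
Proof.
move=> /asboolP[a ha]; apply/asboolP; exists a => i j hi.
by rewrite /= ha // compm0.
Qed.

Definition stable_precomp (u : chain_map X' X) :
    cocomplex_map (stable_hom X Y) (stable_hom X' Y) :=
  quot_cocomplex_map (@bounded_cod X Y) (@bounded_cod X' Y) (bounded_precomp u).

Definition stable_postcomp (u : chain_map Y Y') :
    cocomplex_map (stable_hom X Y) (stable_hom X Y') :=
  quot_cocomplex_map (@bounded_cod X Y) (@bounded_cod X Y') (bounded_postcomp u).

End StableFunctor.

End HomComplexFunctor.

Lemma choice_dep (I : Type) (V : I -> Type) (P : forall i, V i -> Prop) :
  (forall i, exists t, P i t) -> exists s, forall i, P i (s i).
Proof.
by move=> h; exists (fun i => sval (cid (h i))) => i; apply: svalP.
Qed.

Section Lifting.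
Variables (C : extriangulated) (xi : triangle_class C).
Variables (X : complex C) (N : C) (Q : resolution xi N) (n : int).
Hypothesis projX : forall i, projective xi (X i).

Lemma cochain_lift (f : mor (X n) N) : f \oc diff X (n + 1) n = 0 ->
  exists p : cochain X Q n,
    hom_cod_fun (n + 1) p = 0 /\ aug Q \oc cochain_val p n 0 = f.
Proof.
move=> hf; have [neg _ [K [g [q [e [hxi hd haug]]]]]] := resP Q.
pose F i : mor (X i) N :=
  if n =P i is ReflectT h then ecast j (mor (X j) N) h f else 0.
have Fn : F n = f by rewrite /F; case: eqP => // h; rewrite eq_axiomK.
have F0 i : i != n -> F i = 0 by rewrite /F eq_sym; case: eqP.
have Fd i j : F i \oc diff X j i = 0.
  have [->|hi] := eqVneq i n; last by rewrite F0 // comp0m.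
  rewrite Fn; have [->//|hj] := eqVneq j (n + 1).
  by rewrite d_shape ?compm0.
pose A (k : nat) (s : forall i, mor (X i) (Q k)) :=
  (forall i, i != k%:Z + n -> s i = 0) /\
  (forall i j, q k \oc s i \oc diff X j i = 0).
have [s0 [A0 hs0]] : exists s, A 0%N s /\ forall i, q 0%N \oc s i = F i.
  have /choice_dep[s hs] : forall i, exists t : mor (X i) (Q 0%N),
      (i != 0%:Z + n -> t = 0) /\ q 0%N \oc t = F i.
    move=> i; have [->|hi] := eqVneq i n.
      have [_ _ /(_ (F n))[t ht]] := projX n (hxi 0%N).
      by exists t; split => //; rewrite add0r eqxx.
    by exists 0; split => //; rewrite compm0 F0.
  exists s; split; last by move=> i; have [] := hs i.
  split=> [i|i j]; have [h1 h2] := hs i; first exact: h1.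
  by rewrite h2 Fd.
have step (k : nat) (s : forall i, mor (X i) (Q k)) : A k s -> exists s', A k.+1 s' /\
    forall i : int, diff Q k.+1 k \oc s' i = (s (i - 1) \oc diff X i (i - 1)) *~ (-1) ^ n.
  move=> [h1 h2].
  have /choice_dep[s' hs'] : forall i, exists t : mor (X i) (Q k.+1),
      [/\ i != k.+1%:Z + n -> t = 0, forall j, q k.+1 \oc t \oc diff X j i = 0 &
          diff Q k.+1 k \oc t = (s (i - 1) \oc diff X i (i - 1)) *~ (-1) ^ n].
    move=> i; have [hi|hi] := eqVneq i (k.+1%:Z + n); last first.
      exists 0; split=> // [j|]; rewrite compm0 ?comp0m //.
      rewrite h1 ?comp0m ?mul0rz //; apply: contra hi => /eqP hi.
      by apply/eqP; lia.
    set r := _ *~ _.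
    have [_ ex _] := projX i (hxi k).
    have [h hh] : exists h, g k \oc h = r.
      by apply/ex; rewrite /postcomp compZr compA h2 mul0rz.
    have [_ _ /(_ h)[t ht]] := projX i (hxi k.+1).
    exists t; split=> // [j|]; last by rewrite hd -compA -hh -ht.
    have [inj _ _] := projX j (hxi k); apply: inj.
    rewrite /postcomp compm0 [q _ \oc t]ht compA hh /r compZl -compA d_d.
    by rewrite compm0 mul0rz.
  exists s'; split; last by move=> i; have [] := hs' i.
  by split=> [i|i j]; have [] := hs' i.
pose T (k : nat) := {s : forall i, mor (X i) (Q k%:Z) | A k s}.
pose next (k : nat) (t : T k) : T k.+1 :=
  let u := cid (step k (sval t) (svalP t)) in exist _ (sval u) (svalP u).1.
pose fix seq (k : nat) : T k := if k is l.+1 then next l (seq l) else exist _ s0 A0.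
have seqS (k : nat) (i : int) : diff Q k.+1 k \oc sval (seq k.+1) i =
    (sval (seq k) (i - 1) \oc diff X i (i - 1)) *~ (-1) ^ n.
  exact: (svalP (cid (step k (sval (seq k)) (svalP (seq k))))).2.
pose pv (i j : int) : mor (X i) (Q j) :=
  if j is Posz k then sval (seq k) i else 0.
have hp : pv \in degree_pred X Q n.
  apply/asboolP => i [k|//] h; exact: (svalP (seq k)).1.
exists (Cochain hp); split; last by rewrite /= -haug hs0 Fn.
apply: cochain_ext => i j hij; rewrite cochain0E /= /hom_cod_val /=.
rewrite hij !eqxx /= -hij; case: j hij => [k|k] hij.
  have -> : k%:Z + 1 = k.+1%:Z by lia.
  by rewrite /pv seqS subrr.
have -> : pv (i - 1) (Negz k) = 0 by [].
rewrite comp0m mul0rz subr0 -[diff Q _ _]comp1m neg //.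
by rewrite !comp0m.
Qed.

End Lifting.

Section RelativeCohomology.
Variables (C : extriangulated) (xi : triangle_class C).
Implicit Types A B X M N : C.

Lemma resolution_projective M (P : resolution xi M) (i : int) :
  projective xi (P i).
Proof.
have [neg nonneg _] := resP P; case: i => k; first exact: nonneg.
have h0 N (h : mor (P (Negz k)) N) : h = 0 by rewrite -[h]compm1 neg ?compm0.
move=> A B X x y e _; split=> [h h' _|h|h]; first by rewrite (h0 _ h) (h0 _ h').
  by split=> _; [exists 0; rewrite (h0 _ h) | rewrite (h0 _ h)]; exact: h0.
by exists 0; rewrite (h0 _ h); exact: h0.
Qed.

Lemma aug_d M (P : resolution xi M) : aug P \oc diff P (0 + 1) 0 = 0.
Proof.
have [_ nonneg [K [g [q [e [hxi hd <-]]]]]] := resP P.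
have [_ ex _] := nonneg 1%N _ _ _ _ _ _ (hxi 0%N).
by rewrite add0r (hd 0%N); apply/ex; exists (q 1%N).
Qed.

Definition is_lift M M' (f : mor M M') (P : resolution xi M)
  (P' : resolution xi M') (u : chain_map P P') : Prop :=
  aug P' \oc u 0 = f \oc aug P.

Lemma lift_exists M M' (f : mor M M') (P : resolution xi M)
  (P' : resolution xi M') : exists u, @is_lift M M' f P P' u.
Proof.
have hf : (f \oc aug P) \oc diff P (0 + 1) 0 = 0 by rewrite -compA aug_d compm0.
have [p [hp hp0]] := cochain_lift P' (@resolution_projective M P) hf.
have comm i j : cochain_val p j j \oc diff P i j = diff P' i j \oc cochain_val p i i.
  have [->|hij] := eqVneq i (j + 1); last by rewrite !d_shape // compm0 comp0m.
  have : cochain_val (hom_cod_fun (0 + 1) p) (j + 1) j = 0 by rewrite hp.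
  rewrite /= /hom_cod_val add0r !eqxx /= expr0z mulr1z addrK.
  by move/eqP; rewrite subr_eq0 => /eqP->.
by exists (ChainMap comm).
Qed.

Definition res_lift M M' (f : mor M M') (P : resolution xi M)
  (P' : resolution xi M') : chain_map P P' := sval (cid (lift_exists f P P')).

Section Horseshoe.
Variables (A B X : C) (x : mor A B) (y : mor B X).

Record horseshoe (P : resolution xi A) (P'' : resolution xi X) := Horseshoe {
  hs_mid :> resolution xi B;
  hs_in : chain_map P hs_mid;
  hs_out : chain_map hs_mid P'';
  hs_lift_in : is_lift x hs_in;
  hs_lift_out : is_lift y hs_out;
  hs_split : forall n,
    exists (s : mor (P'' n) (hs_mid n)) (r : mor (hs_mid n) (P n)),
      [/\ r \oc hs_in n = idm (P n), hs_out n \oc s = idm (P'' n) &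
          hs_in n \oc r + s \oc hs_out n = idm (hs_mid n)] }.

Variables (P : resolution xi A) (P'' : resolution xi X).
Variables (H : horseshoe P P'') (N : C).

Fact horseshoe_exact n :
  short_exact (homto_map (hs_out H) N n) (homto_map (hs_in H) N n).
Proof.
have [s [r [ri os irso]]] := hs_split H n.
have oi : hs_out H n \oc hs_in H n = 0.
  have := congr1 (fun t => hs_out H n \oc (t \oc hs_in H n)) irso.
  rewrite comp1m compDl compDr -!compA ri compm1 (compA _ _ (_ \oc _)) os comp1m.
  by move/eqP; rewrite -subr_eq0 addrK => /eqP.
split=> [h h' e|h|h].
- by rewrite -[h]compm1 -[h']compm1 -os !compA; congr (_ \oc _); exact: e.
- split=> [e|[h' <-]]; last by rewrite /= /precomp -compA oi compm0.
  exists (h \oc s); rewrite /= /precomp -compA -[RHS]compm1 -irso compDr.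
  by rewrite [h \oc (_ \oc r)]compA [h \oc hs_in H n]e comp0m add0r.
by exists (h \oc r); rewrite /= /precomp -compA ri compm1.
Qed.

Definition ext_connecting (n : int) :
    cohomology (homto P N) n -> cohomology (homto P'' N) (n + 1) :=
  connecting horseshoe_exact (n := n).

End Horseshoe.

Record complete_resolution M (P : resolution xi M) := CompleteResolution {
  cr_cplx :> complex C;
  cr_map : chain_map cr_cplx P;
  cr_complete : is_complete_resolution xi cr_cplx;
  cr_id : exists m : int, forall i, m <= i -> is_id (cr_map i) }.

Fact is_id_factor A B Z (u : mor A B) (h : mor A Z) :
  is_id u -> exists h', h' \oc u = h.
Proof. by case: _ /; exists h; rewrite compm1. Qed.

Fact is_id_epi A B Z (u : mor A B) (h : mor B Z) :
  is_id u -> h \oc u = 0 -> h = 0.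
Proof. by move=> hu; move: h; case: _ / hu => h; rewrite compm1. Qed.

Section Identification.
Variables (M N : C) (P : resolution xi M) (Q : resolution xi N).
Variables (T : complete_resolution P) (n : int).

(* Graph of the isomorphism H^n C(T, N) = H^n (C(P, Q) / bounded) given by    *)
(*   C(T, N) <- C(T, Q) -> C(T, Q) / bounded <- C(P, Q) / bounded,            *)
(* where the maps are composition with Q -> N, the projection, and            *)
(* composition with T -> P; all three are isomorphisms on cohomology.         *)
Definition identification_rel (t : cohomology (homto T N) n)
    (b : cohomology (stable_hom P Q) n) : Prop :=
  exists (z : cocycle (homto T N) n) (p : cocycle (hom_cocomplex T Q) n),
    [/\ coclass z = t, aug Q \oc cochain_val (val p) n 0 = val z &
        cohomology_map (stable_precomp Q (cr_map T)) n b =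
        cohomology_map (stable_proj T Q) n (coclass p)].

Lemma identification_total t : exists b, identification_rel t b.
Proof.
have [K [projT _]] := cr_complete T; have [m hm] := cr_id T.
pose z : cocycle (homto T N) n := repr t.
have hz : coclass z = t by apply: reprK.
have [p [hp hpz]] := cochain_lift Q projT (cocycleP z).
have hpk : (p : hom_cocomplex T Q n) \in
    ker_pred (cod (hom_cocomplex T Q) n (n + 1)) by rewrite unfold_in; apply/eqP.
have /choice_dep[c hc] : forall i, exists c : forall j, mor (P i) (Q j),
    forall j, (i != j + n -> c j = 0) /\
      (m <= i -> c j \oc cr_map T i = cochain_val p i j).
  move=> i; apply: (@choice_dep int (fun j => mor (P i) (Q j)) (fun j c =>
    (i != j + n -> c = 0) /\
    (m <= i -> c \oc cr_map T i = cochain_val p i j))) => j.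
  have [hij|hij] := eqVneq i (j + n); last first.
    by exists 0; split=> // _; rewrite comp0m cochain_shape.
  have [hi|hi] := leP m i; last by exists 0; split.
  by have [c hc] := is_id_factor (cochain_val p i j) (hm i hi); exists c.
have hcd : (c : bifamily _) \in degree_pred P Q n.
  by apply/asboolP => i j h; have [-> //] := hc i j.
pose q : hom_cocomplex P Q n := Cochain hcd.
have hqb : cod (hom_cocomplex P Q) n (n + 1) q \in bounded P Q (n + 1).
  apply/asboolP; exists (m + 1) => i j hi.
  have hi' : m <= i by lia.
  suff e : cochain_val (hom_cod_fun (n + 1) q) i j \oc cr_map T i = 0.
    exact: is_id_epi (hm i hi') e.
  have -> : 0 = cochain_val (hom_cod_fun (n + 1) p) i j by rewrite hp.
  rewrite /= /hom_cod_val; case: ifP => _; last by rewrite comp0m.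
  rewrite compBl compZl -!compA -chmapC [c (i - 1) j \oc _]compA.
  by rewrite !(hc _ _).2 //; lia.
have hqk : \pi_(Quotient.quot (bounded P Q n))%qT q \in
    ker_pred (cod (stable_hom P Q) n (n + 1)).
  rewrite unfold_in; apply/eqP.
  change (quot_map (@bounded_cod C P Q n (n + 1))
    (\pi_(Quotient.quot (bounded P Q n))%qT q) = 0); rewrite quot_mapE.
  rewrite -[RHS](raddf0 \pi_(Quotient.quot (bounded P Q (n + 1)))%qT).
  by apply/eqP; rewrite -Quotient.idealrBE subr0.
pose b : cocycle (stable_hom P Q) n := Kernel hqk.
pose r : cocycle (hom_cocomplex T Q) n := Kernel hpk.
exists (coclass b), z, r; split=> //.
rewrite !cohomology_mapE; congr coclass; apply: val_inj.
change (quot_map (@bounded_precomp C T P Q (cr_map T) n)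
  (\pi_(Quotient.quot (bounded P Q n))%qT q) =
  \pi_(Quotient.quot (bounded T Q n))%qT (p : hom_cocomplex T Q n)).
rewrite quot_mapE; apply/eqP; rewrite -Quotient.idealrBE.
apply/asboolP; exists m => i j hi.
by rewrite cochainBE /=; have [_ ->//] := hc i j; rewrite subrr.
Qed.

Definition identification (t : cohomology (homto T N) n) :
  cohomology (stable_hom P Q) n := sval (cid (identification_total t)).

Definition comparison_map (a : cohomology (homto P N) n) :
    cohomology (stable_hom P Q) n :=
  identification (cohomology_map (homto_map (cr_map T) N) n a).

End Identification.

(* xt and cxt are defined through a choice R of a resolution of every object;  *)
(* other choices give canonically isomorphic groups.                          *)
Section Groups.
Variable R : forall M, resolution xi M.

Definition xt (n : int) (M N : C) : zmodType := cohomology (homto (R M) N) n.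

Definition cxt (n : int) (M N : C) : zmodType :=
  cohomology (stable_hom (R M) (R N)) n.

Definition cxt_mapl (n : int) M M' (f : mor M M') (N : C) :
    {additive cxt n M' N -> cxt n M N} :=
  cohomology_map (stable_precomp (R N) (res_lift f (R M) (R M'))) n.

Definition cxt_mapr (n : int) (M : C) N N' (g : mor N N') :
    {additive cxt n M N -> cxt n M N'} :=
  cohomology_map (stable_postcomp (R M) (res_lift g (R N) (R N'))) n.

End Groups.

End RelativeCohomology.

Section ResolutionExists.
Variables (C : extriangulated) (xi : triangle_class C).
Hypothesis enough : enough_projectives xi.

Lemma resolution_exists (M : C) : inhabited (resolution xi M).
Proof.
have /choice_dep[Om /choice_dep[P0 /choice_dep[g0 /choice_dep[q0 h0]]]] := enough.
have {h0} /choice_dep[e0 h0] := h0.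
pose S (n : nat) : C := iter n Om M.
pose P (n : nat) : C := P0 (S n).
pose dn (n : nat) : mor (P n.+1) (P n) := g0 (S n) \oc q0 (S n.+1).
have dn_dn n : dn n \oc dn n.+1 = 0.
  have qg : q0 (S n.+1) \oc (g0 (S n.+1) \oc q0 (S n.+2)) = 0.
    have [_ ex _] := (h0 (S n.+2)).2 _ _ _ _ _ _ (h0 (S n.+1)).1.
    by apply/ex; exists (q0 (S n.+2)).
  by rewrite /dn -compA qg compm0.
pose ob (i : int) : C := if i is Posz n then P n else zob C.
pose dd (i j : int) : mor (ob i) (ob j) :=
  match i, j with
  | Posz a, Posz b =>
      if b.+1 =P a is ReflectT h then ecast k (mor (P k) (P b)) h (dn b) else 0
  | _, _ => 0
  end.
have ddE (n : nat) : dd n.+1 n = dn n.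
  by rewrite /dd; case: eqP => // h; rewrite eq_axiomK.
have dd_shape i j : i != j + 1 -> dd i j = 0.
  case: i j => [a|a] [b|b] //= h; case: eqP => // hab; case/eqP: h.
  by rewrite -hab; lia.
have dd_dd i j k : dd j k \oc dd i j = 0.
  have [->|h] := eqVneq i (j + 1); last by rewrite (dd_shape i j) ?compm0.
  have [->|h] := eqVneq j (k + 1); last by rewrite (dd_shape j k) ?comp0m.
  case: k => [n|n]; last first.
    have -> : dd (Negz n + 1) (Negz n) = 0 by case: (Negz n + 1).
    by rewrite comp0m.
  have -> : n%:Z + 1 = n.+1 by lia.
  have -> : n.+1%:Z + 1 = n.+2 by lia.
  by rewrite !ddE dn_dn.
pose X : complex C := Complex dd_shape dd_dd.
have hX : @is_resolution C xi X M (q0 M).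
  split; [by case=> // n _; exact: zob_id|by move=> n; exact: (h0 _).2|].
  pose syz (n : nat) : C := S n.+1.
  exists syz, (fun n => g0 (S n)).
  exists (fun n => if n is m.+1 return mor (P n) (syzygy M syz n)
                   then q0 (S m.+1) else q0 M).
  exists (fun n => if n is m.+1 return exE C (syzygy M syz n) (S n.+1)
                   then e0 (S m.+1) else e0 M).
  by split=> [[|n]|n|] //; exact: (h0 _).1.
by exists; exists X (q0 M).
Qed.

End ResolutionExists.

(* Main.v *)
(* Let P -> A, Q -> B, R -> X be the chosen resolutions.  Mapping from        *)
(* xi-projectives turns A -> B -> X into short exact sequences, so a lift     *)
(* R_0 -> B of the augmentation of X yields a cocycle t : R -> P of degree 1, *)
(* unique up to homotopy, and the connecting map is [q] |-> [q t].  With lifts *)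
(* i : P -> Q and p : Q -> R of x and y, the composites p i, i t and - t p    *)
(* are coboundaries of cochains m, s and r, whose augmentations can be chosen *)
(* so that r i - t m, s p + i r and p s - m t are homotopic to identities.    *)
(* Exactness follows by composing these relations with cochains into the      *)
(* resolution of N, everything modulo bounded cochains.                       *)
(* The comparison map sends the class of z to the class of any cocycle P -> Q' *)
(* lifting z : P_n -> N through the resolution Q' of N, and a horseshoe with  *)
(* degreewise splittings r', s' has connecting map [z] |-> [z r' d s'], where *)
(* r' d s' is again such a cocycle t.                                         *)

Require Import Defs.
From HB Require Import structures.
From mathcomp Require Import all_boot all_order all_algebra.
From mathcomp Require Import boolp zify.

Set Implicit Arguments.
Unset Strict Implicit.
Unset Printing Implicit Defensive.

Import Order.TTheory GRing.Theory Num.Theory.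
Local Open Scope ring_scope.

(** Up to homotopy, projective resolutions of the three terms of a triangle in [xi] form a
    distinguished triangle P -> Q -> R -> P[1], whose last arrow is the degree-one cocycle t of the
    extension. A contravariant Hom functor turns such a triangle into a long exact sequence. This
    survives division by bounded cochains, because composing a bounded cochain with a fixed cochain
    leaves it bounded. Instead of building mapping cones, the proof keeps explicit cochains m, r, s
    and three homotopies that witness the triangle ([triangle_homotopies]). Exactness is then
    algebra with [leibniz], carried out in [triangle_exact1], [triangle_exact2] and
    [triangle_exact3].

    All homotopies come from one principle, [acyclic_lift]: on complexes of projectives, composing
    with an augmentation is a quasi-isomorphism, so cochains can be built with a prescribed
    differential and a prescribed augmentation. It also makes t unique up to homotopy and compatible
    with morphisms of triangles ([ext_cocycle_natural]), which gives naturality in the triangle;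
    naturality in N is associativity of composition. For the comparison maps,
    [represents_comparison] computes them on P itself and [horseshoe_cocycle] identifies the
    classical connecting map, so both composites send the class of z to the class of q t, where q
    lifts z. *)

Lemma sign_sqr (n : int) : (-1) ^ n * (-1) ^ n = 1 :> int.
Proof. by rewrite -exprzMl ?unitrN1 // mulrNN mulr1 exp1rz. Qed.

Lemma sign_pred (n : int) : (-1) ^ (n - 1) = - (-1) ^ n :> int.
Proof. by rewrite exprzDr ?unitrN1 // exprN1 invrN1 mulrN1. Qed.

Lemma sign_succ (n : int) : (-1) ^ (n + 1) = - (-1) ^ n :> int.
Proof. by rewrite exprzDr ?unitrN1 // expr1z mulrN1. Qed.

(** * Composition of cochains *)

Section CochainCalculus.
Variable C : additive_category.
Implicit Types X Y Z : complex C.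

Lemma compNl (A B N : C) (g : mor B N) (f : mor A B) :
  (- g) \oc f = - (g \oc f).
Proof. exact: (raddfN (precomp f)). Qed.

Lemma compNr (A B N : C) (g : mor B N) (f : mor A B) :
  g \oc (- f) = - (g \oc f).
Proof. exact: (raddfN (postcomp g)). Qed.

Definition entry X Y n i j (p : cochain X Y n) : mor (X i) (Y j) :=
  cochain_val p i j.

Arguments entry : simpl never.

Fact entryB X Y n i j : zmod_morphism (@entry X Y n i j).
Proof. by []. Qed.

HB.instance Definition _ X Y n i j := GRing.isZmodMorphism.Build
  (cochain X Y n) (mor (X i) (Y j)) (@entry X Y n i j) (@entryB X Y n i j).

Lemma entryBE X Y n i j (p q : cochain X Y n) :
  entry i j (p - q) = entry i j p - entry i j q.
Proof. by []. Qed.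

Lemma entryDE X Y n i j (p q : cochain X Y n) :
  entry i j (p + q) = entry i j p + entry i j q.
Proof. exact: (raddfD (@entry X Y n i j)). Qed.

Lemma entryZE X Y n i j (p : cochain X Y n) z :
  entry i j (p *~ z) = entry i j p *~ z.
Proof. exact: (raddfMz (@entry X Y n i j)). Qed.

Lemma entryNE X Y n i j (p : cochain X Y n) : entry i j (- p) = - entry i j p.
Proof. exact: (raddfN (@entry X Y n i j)). Qed.

Lemma entry0E X Y n i j : entry i j (0 : cochain X Y n) = 0.
Proof. by []. Qed.

Lemma entry_shape X Y n (p : cochain X Y n) i j : i != j + n -> entry i j p = 0.
Proof. exact: cochain_shape. Qed.

Lemma entry_ext X Y n (p q : cochain X Y n) :
  (forall i j, i = j + n -> entry i j p = entry i j q) -> p = q.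
Proof. exact: cochain_ext. Qed.

Lemma entry_cod X Y n m (p : cochain X Y n) i j : m = n + 1 -> i = j + m ->
  entry i j (hom_cod_fun m p) = diff Y (j + 1) j \oc entry i (j + 1) p
    - (entry (i - 1) j p \oc diff X i (i - 1)) *~ (-1) ^ n.
Proof. by move=> -> ->; rewrite /entry /= /hom_cod_val !eqxx. Qed.

Definition hcomp_val X Y Z n m k (q : cochain Y Z n) (p : cochain X Y m) :
    bifamily (fun i j => mor (X i) (Z j)) := fun i j =>
  if i == j + k then entry (i - m) j q \oc entry i (i - m) p else 0.

Fact hcomp_subproof X Y Z n m k (q : cochain Y Z n) (p : cochain X Y m) :
  hcomp_val k q p \in degree_pred X Z k.
Proof. by apply/asboolP => i j /negbTE h; rewrite /hcomp_val h. Qed.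

(* The composite is meaningful only when k = n + m; a free target degree      *)
(* avoids transports along equations between integers.                        *)
Definition hcomp X Y Z n m k (q : cochain Y Z n) (p : cochain X Y m) :
  cochain X Z k := Cochain (hcomp_subproof k q p).

Fact entry_hcompE X Y Z (n m k : int) (q : cochain Y Z n) (p : cochain X Y m)
    (i j : int) : entry i j (hcomp k q p) =
  if i == j + k then entry (i - m) j q \oc entry i (i - m) p else 0.
Proof. by []. Qed.

(** No condition links [i] to [j]: off the diagonal of degree [k] the right-hand side vanishes as
    well, because [q] does. *)
Lemma entry_hcomp X Y Z (n m k : int) (q : cochain Y Z n) (p : cochain X Y m)
    (i l j : int) : k = n + m -> i = l + m ->
  entry i j (hcomp k q p) = entry l j q \oc entry i l p.
Proof.
move=> hk hi; have <- : i - m = l by lia.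
rewrite entry_hcompE; case: eqP => // hij.
by rewrite [entry _ j q]entry_shape ?comp0m //; lia.
Qed.

Fact chain_cochain_subproof X Y (u : chain_map X Y) :
  (fun i j => if i =P j is ReflectT h then ecast k (mor (X i) (Y k)) h (u i)
              else 0) \in degree_pred X Y 0.
Proof. by apply/asboolP => i j; rewrite addr0; case: eqP. Qed.

Definition chain_cochain X Y (u : chain_map X Y) : cochain X Y 0 :=
  Cochain (chain_cochain_subproof u).

Lemma entry_chain X Y (u : chain_map X Y) i :
  entry i i (chain_cochain u) = u i.
Proof. by rewrite /entry /=; case: eqP => // h; rewrite eq_axiomK. Qed.

Lemma chain_cochain_cocycle X Y (u : chain_map X Y) m :
  hom_cod_fun m (chain_cochain u) = 0.
Proof.
have [->|hm] := eqVneq m (0 + 1); last exact: (@hom_cod_shape C X Y).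
apply: entry_ext => i j hij; rewrite entry_cod // expr0z mulr1z.
have -> : i - 1 = j by lia.
have -> : i = j + 1 by lia.
by rewrite !entry_chain chmapC subrr.
Qed.

Lemma hcomp_chainr X Y Z n (q : cochain Y Z n) (u : chain_map X Y) :
  hcomp n q (chain_cochain u) = hom_precomp_fun u q.
Proof.
apply: entry_ext => i j _.
by rewrite (@entry_hcomp _ _ _ _ _ _ _ _ _ i) ?addr0 // entry_chain.
Qed.

Lemma hcomp_chainl X Y Z n (p : cochain X Y n) (u : chain_map Y Z) :
  hcomp n (chain_cochain u) p = hom_postcomp_fun u p.
Proof.
apply: entry_ext => i j hij.
by rewrite (@entry_hcomp _ _ _ _ _ _ _ _ _ j) ?add0r // entry_chain.
Qed.

Lemma entry_hcomp_chainr X Y Z n (q : cochain Y Z n) (u : chain_map X Y) i j :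
  entry i j (hcomp n q (chain_cochain u)) = entry i j q \oc u i.
Proof. by rewrite hcomp_chainr. Qed.

Lemma entry_hcomp_chainl X Y Z n (p : cochain X Y n) (u : chain_map Y Z) i j :
  entry i j (hcomp n (chain_cochain u) p) = u j \oc entry i j p.
Proof. by rewrite hcomp_chainl. Qed.

Fact idc_comm X i j : idm (X j) \oc diff X i j = diff X i j \oc idm (X i).
Proof. by rewrite comp1m compm1. Qed.

Definition id_chain X : chain_map X X := ChainMap (@idc_comm X).

Lemma hcomp_id X Y n (q : cochain X Y n) :
  hcomp n q (chain_cochain (id_chain X)) = q.
Proof.
rewrite hcomp_chainr; apply: entry_ext => i j _.
by rewrite /entry /= compm1.
Qed.

Section Bilinear.
Variables (X Y Z : complex C) (n m k : int).
Implicit Types (q : cochain Y Z n) (p : cochain X Y m).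

Fact hcomp_zmodl p : zmod_morphism (fun q => hcomp k q p).
Proof.
move=> q q'; apply: entry_ext => i j _; rewrite entryBE !entry_hcompE.
by case: eqP => _; rewrite ?subrr // entryBE compBl.
Qed.

Fact hcomp_zmodr q : zmod_morphism (@hcomp X Y Z n m k q).
Proof.
move=> p p'; apply: entry_ext => i j _; rewrite entryBE !entry_hcompE.
by case: eqP => _; rewrite ?subrr // entryBE compBr.
Qed.

(** The arguments are swapped so that additivity in the left factor can be registered as an
    instance. *)
Definition hcompl p q : cochain X Z k := hcomp k q p.

HB.instance Definition _ p := GRing.isZmodMorphism.Build
  (cochain Y Z n) (cochain X Z k) (hcompl p) (hcomp_zmodl p).
HB.instance Definition _ q := GRing.isZmodMorphism.Build
  (cochain X Y m) (cochain X Z k) (@hcomp X Y Z n m k q) (hcomp_zmodr q).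

Lemma hcompDl p q q' : hcomp k (q + q') p = hcomp k q p + hcomp k q' p.
Proof. exact: (raddfD (hcompl p)). Qed.
Lemma hcompBl p q q' : hcomp k (q - q') p = hcomp k q p - hcomp k q' p.
Proof. exact: (raddfB (hcompl p)). Qed.
Lemma hcompNl p q : hcomp k (- q) p = - hcomp k q p.
Proof. exact: (raddfN (hcompl p)). Qed.
Lemma hcompNr p q : hcomp k q (- p) = - hcomp k q p.
Proof. exact: raddfN. Qed.
Lemma hcompZl p q z : hcomp k (q *~ z) p = hcomp k q p *~ z.
Proof. exact: (raddfMz (hcompl p)). Qed.
Lemma hcomp0l p : hcomp k (0 : cochain Y Z n) p = 0.
Proof. exact: (raddf0 (hcompl p)). Qed.

End Bilinear.

Lemma hcompA X Y Z W (n m l a b k : int) (q : cochain Z W n) (p : cochain Y Z m)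
    (o : cochain X Y l) : a = n + m -> b = m + l -> k = n + b ->
  hcomp k (hcomp a q p) o = hcomp k q (hcomp b p o).
Proof.
move=> ha hb hk; apply: entry_ext => i j hij.
rewrite (@entry_hcomp _ _ _ a l k _ o i (i - l)); [|lia..].
rewrite (@entry_hcomp _ _ _ n m a q p (i - l) (i - b)); [|lia..].
rewrite (@entry_hcomp _ _ _ n b k q _ i (i - b)); [|lia..].
rewrite (@entry_hcomp _ _ _ m l b p o i (i - l)); [|lia..].
by rewrite Defs.compA.
Qed.

(** The two terms passing through the differential of [Y] cancel, and the signs of the outer ones
    multiply. *)
Lemma leibniz X Y Z (n m k n' m' k' : int) (q : cochain Y Z n)
    (p : cochain X Y m) : k = n + m -> n' = n + 1 -> m' = m + 1 -> k' = k + 1 ->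
  hom_cod_fun k' (hcomp k q p) =
  hcomp k' (hom_cod_fun n' q) p + hcomp k' q (hom_cod_fun m' p) *~ (-1) ^ n.
Proof.
move=> hk hn hm hk'; apply: entry_ext => i j hij.
rewrite entry_cod // entryDE entryZE.
rewrite (@entry_hcomp _ _ _ n m k q p i (i - m)); [|lia..].
rewrite (@entry_hcomp _ _ _ n m k q p (i - 1) (i - m')); [|lia..].
rewrite (@entry_hcomp _ _ _ n' m k' _ p i (i - m)); [|lia..].
rewrite (@entry_hcomp _ _ _ n m' k' q _ i (i - m')); [|lia..].
rewrite !entry_cod //; [|lia..].
have -> : i - m' + 1 = i - m by lia.
have -> : i - m - 1 = i - m' by lia.
rewrite compBl compBr compZl compZr !Defs.compA mulrzBl -mulrzA hk.
rewrite exprzDr ?unitrN1 // [(-1) ^ n * _]mulrC.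
by rewrite addrA subrK.
Qed.

Lemma hcomp_cocycle X' X Y (n m k : int) (c : cochain X' X m)
    (q : cochain X Y n) :
    hom_cod_fun (m + 1) c = 0 -> k = n + m ->
  hom_cod_fun (k + 1) (hcomp k q c) = hcomp (k + 1) (hom_cod_fun (n + 1) q) c.
Proof.
move=> hc hk; rewrite (@leibniz _ _ _ n m k (n + 1) (m + 1)) // hc.
by rewrite raddf0 mul0rz addr0.
Qed.

End CochainCalculus.

(** * Lifting through the augmentation of a resolution *)

Section Lifting.
Variables (C : extriangulated) (xi : triangle_class C).
Variables (X : complex C) (N : C) (Q : resolution xi N) (n m : int).
Hypothesis projX : forall i, projective xi (X i).

(* Hom(X, Q) -> Hom(X, N) is a quasi-isomorphism, in the form: a pair (p, g)  *)
(* which is a cocycle of its mapping cone is a coboundary there.              *)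
Lemma acyclic_lift (p : cochain X Q m) (g : mor (X n) N) : m = n + 1 ->
    hom_cod_fun (m + 1) p = 0 ->
    aug Q \oc entry m 0 p = - (g \oc diff X m n) *~ (-1) ^ n ->
  exists h : cochain X Q n, hom_cod_fun m h = p /\ aug Q \oc entry n 0 h = g.
Proof.
move=> hm hp hg; have [neg _ [K [k [q [e [hxi hd haug]]]]]] := resP Q.
have sgn : (-1) ^ n * (-1) ^ n = 1 :> int.
  by rewrite -exprzMl ?unitrN1 // mulrNN mulr1 exp1rz.
pose G i : mor (X i) N :=
  if n =P i is ReflectT h then ecast j (mor (X j) N) h g else 0.
have Gn : G n = g by rewrite /G; case: eqP => // h; rewrite eq_axiomK.
have G0 i : i != n -> G i = 0 by rewrite /G eq_sym; case: eqP.
(* The required equation in row [l] reads: differential of row [l + 1] of the cochain equals [R l]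
   of row [l]. The invariant [A] says that [R l s] is killed by [q l], hence factors through the
   next syzygy and can be lifted. *)
pose R (l : nat) (s : forall i, mor (X i) (Q l)) (i : int) : mor (X i) (Q l) :=
  entry i l p + (s (i - 1) \oc diff X i (i - 1)) *~ (-1) ^ n.
pose A (l : nat) (s : forall i, mor (X i) (Q l)) :=
  (forall i, i != l%:Z + n -> s i = 0) /\ (forall i, q l \oc R l s i = 0).
have R0 l s i : A l s -> i != l%:Z + m -> R l s i = 0.
  move=> [h1 _] hi; rewrite /R entry_shape // add0r h1 ?comp0m ?mul0rz //.
  by apply: contraNneq hi => hi; apply/eqP; lia.
have [s0 [A0 hs0]] : exists s, A 0%N s /\ q 0%N \oc s n = g.
  have /choice_dep[s hs] : forall i, exists t : mor (X i) (Q 0%N),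
      (i != 0%:Z + n -> t = 0) /\ q 0%N \oc t = G i.
    move=> i; have [->|hi] := eqVneq i n.
      have [_ _ /(_ (G n))[t ht]] := projX n (hxi 0%N).
      by exists t; split => //; rewrite add0r eqxx.
    by exists 0; split => //; rewrite compm0 G0.
  exists s; split; last by rewrite (hs n).2 Gn.
  split=> [i|i]; first exact: (hs i).1.
  rewrite /R compDr compZr Defs.compA (hs _).2.
  have [->|hi] := eqVneq i m.
    have -> : m - 1 = n by lia.
    by rewrite Gn haug hg mulNrz addNr.
  by rewrite entry_shape ?G0 ?compm0 ?comp0m ?mul0rz ?addr0 //; lia.
have step (l : nat) (s : forall i, mor (X i) (Q l)) : A l s ->
    exists s', A l.+1 s' /\ forall i : int, diff Q l.+1 l \oc s' i = R l s i.
  move=> As; have /choice_dep[s' hs'] : forall i, exists t : mor (X i) (Q l.+1),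
      (i != l.+1%:Z + n -> t = 0) /\ diff Q l.+1 l \oc t = R l s i.
    move=> i; have [hi|hi] := eqVneq i (l.+1%:Z + n); last first.
      by exists 0; split=> //; rewrite compm0 R0 //; lia.
    have [_ ex _] := projX i (hxi l).
    have [t ht] : exists t, k l \oc t = R l s i by apply/ex; exact: As.2.
    have [_ _ /(_ t)[t' ht']] := projX i (hxi l.+1).
    by exists t'; split=> //; rewrite hd -Defs.compA -ht -ht'.
  exists s'; split=> [|i]; last exact: (hs' i).2.
  split=> [i|i]; first exact: (hs' i).1.
  (* After composition with the monic [k l] the map [q l.+1] becomes the differential, and the
     cocycle condition on [p] cancels the two terms of [R]. *)
  have [inj _ _] := projX i (hxi l); apply: inj.
  rewrite /postcomp compm0 Defs.compA -hd /R compDr compZr Defs.compA (hs' _).2.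
  have [hi|hi] := eqVneq i (l%:Z + (m + 1)); last first.
    rewrite entry_shape ?R0 ?compm0 ?comp0m ?mul0rz ?addr0 //; lia.
  have := entry_cod p (erefl (m + 1)) hi; rewrite hp entry0E => /esym/eqP.
  rewrite subr_eq0 => /eqP; have -> : l%:Z + 1 = l.+1 by lia.
  move=> ->; rewrite /R compDl compZl -Defs.compA d_d compm0 mul0rz addr0.
  have -> : (-1) ^ m = - (-1) ^ n :> int.
    by rewrite hm exprzDr ?unitrN1 // expr1z mulrN1.
  by rewrite mulrNz addNr.
pose T (l : nat) := {s : forall i, mor (X i) (Q l%:Z) | A l s}.
pose next (l : nat) (t : T l) : T l.+1 :=
  let u := cid (step l (sval t) (svalP t)) in exist _ (sval u) (svalP u).1.
pose fix seq (l : nat) : T l :=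
  if l is l'.+1 then next l' (seq l') else exist _ s0 A0.
have seqS (l : nat) (i : int) :
    diff Q l.+1 l \oc sval (seq l.+1) i = R l (sval (seq l)) i.
  exact: (svalP (cid (step l (sval (seq l)) (svalP (seq l))))).2.
pose v (i j : int) : mor (X i) (Q j) :=
  if j is Posz l then sval (seq l) i else 0.
have hv : v \in degree_pred X Q n.
  by apply/asboolP => i [l|//] h; exact: (svalP (seq l)).1.
pose w : cochain X Q n := Cochain hv.
have wE (l : nat) i : entry i l w = sval (seq l) i by [].
have wneg l i : entry i (Negz l) w = 0 by [].
exists w; split; last by rewrite -hs0 haug.
apply: entry_ext => i [l|l] hij; rewrite entry_cod //.
  have -> : l%:Z + 1 = l.+1 by lia.
  by rewrite !wE seqS /R addrK.
rewrite wneg comp0m mul0rz subr0 -[diff Q _ _]comp1m -[RHS]comp1m neg //.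
by rewrite !comp0m.
Qed.

End Lifting.

(** * Cochains modulo bounded cochains *)

Section StableClasses.
Variable C : additive_category.
Implicit Types X Y Z : complex C.

Lemma boundedP X Y n (p : cochain X Y n) :
  p \in bounded X Y n <-> exists m : int, forall i j, m <= i -> entry i j p = 0.
Proof. by split=> [/asboolP|h]; last exact/asboolP. Qed.

Lemma bounded_hcompl X Y Z n m k (q : cochain Y Z n) (p : cochain X Y m) :
  q \in bounded Y Z n -> hcomp k q p \in bounded X Z k.
Proof.
move=> /boundedP[a ha]; apply/boundedP; exists (a + m) => i j hi.
by rewrite entry_hcompE; case: ifP => // _; rewrite ha ?comp0m //; lia.
Qed.

(** Coboundaries modulo bounded cochains, stated on honest cochains so that the calculus of [hcomp]
    applies before passing to the quotient. *)
Definition null X Y n (q : cochain X Y n) : Prop :=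
  exists h : cochain X Y (n - 1), q - hom_cod_fun n h \in bounded X Y n.

Lemma nullP X Y n k (q : cochain X Y n) : n = k + 1 ->
  null q <-> exists h : cochain X Y k, q - hom_cod_fun n h \in bounded X Y n.
Proof. by move=> hk; have -> : k = n - 1 by lia. Qed.

Section Null.
Variables (X Y : complex C) (n : int).
Implicit Types p q : cochain X Y n.

Lemma null_bounded q : q \in bounded X Y n -> null q.
Proof. by move=> hq; exists 0; rewrite raddf0 subr0. Qed.

Lemma null_cod k (h : cochain X Y k) : null (hom_cod_fun n h).
Proof.
have [hn|hn] := eqVneq n (k + 1).
  by apply/(nullP _ hn); exists h; rewrite subrr rpred0.
by rewrite hom_cod_shape //; apply: null_bounded; exact: rpred0.
Qed.

Lemma nullB p q : null p -> null q -> null (p - q).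
Proof.
move=> [h hp] [k hq]; exists (h - k); rewrite raddfB /=.
have -> : p - q - (hom_cod_fun n h - hom_cod_fun n k) =
    (p - hom_cod_fun n h) - (q - hom_cod_fun n k).
  by rewrite !opprD !opprK addrACA.
exact: rpredB.
Qed.

Lemma null0 : null (0 : cochain X Y n).
Proof. by apply: null_bounded; exact: rpred0. Qed.

Lemma nullN q : null q -> null (- q).
Proof. by move=> hq; rewrite -sub0r; apply: nullB => //; exact: null0. Qed.

Lemma nullD p q : null p -> null q -> null (p + q).
Proof. by move=> hp hq; rewrite -[q]opprK; apply/nullB/nullN. Qed.

Lemma nullZ q z : null q -> null (q *~ z).
Proof.
by move=> [h hq]; exists (h *~ z); rewrite raddfMz /= -mulrzBl; exact: rpredMz.
Qed.

End Null.

Lemma null_hcompl X Y Z n m k (q : cochain Y Z n) (p : cochain X Y m) :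
  k = n + m -> null q -> hom_cod_fun (m + 1) p = 0 -> null (hcomp k q p).
Proof.
move=> hk [h hq] hp; rewrite -[q](subrK (hom_cod_fun n h)) hcompDl.
apply: nullD; first by apply: null_bounded; exact: bounded_hcompl.
suff -> : hcomp k (hom_cod_fun n h) p = hom_cod_fun k (hcomp (k - 1) h p).
  exact: null_cod.
rewrite (@leibniz _ _ _ _ (n - 1) m (k - 1) n (m + 1)) //; [|lia..].
by rewrite hp raddf0 mul0rz addr0.
Qed.

(** By the Leibniz rule q dh is, up to sign, d(q h) minus (dq) h, and the last term is bounded. Thus
    [q] only has to be a cocycle modulo bounded cochains. *)
Lemma null_hcompr X Y Z n m l k (q : cochain Y Z n) (h : cochain X Y l) :
  k = n + m -> m = l + 1 -> hom_cod_fun (n + 1) q \in bounded Y Z (n + 1) ->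
  null (hcomp k q (hom_cod_fun m h)).
Proof.
move=> hk hm hq.
have -> : hcomp k q (hom_cod_fun m h) =
    hom_cod_fun k (hcomp (n + l) q h *~ (-1) ^ n) -
    hcomp k (hom_cod_fun (n + 1) q) h *~ (-1) ^ n.
  rewrite raddfMz /= (@leibniz _ _ _ _ n l _ (n + 1) m) //; last by lia.
  by rewrite mulrzDl -mulrzA sign_sqr mulr1z addrAC subrr add0r.
apply: nullB; first exact: null_cod.
by apply/nullZ/null_bounded/bounded_hcompl.
Qed.

(** The cochain [q] need not be a cocycle, only one modulo bounded cochains. A relation lets each
    computation use whichever representative is convenient. *)
Definition represents X Y n (q : cochain X Y n)
    (b : cohomology (stable_hom X Y) n) : Prop :=
  exists z : cocycle (stable_hom X Y) n,
    val z = \pi_(Quotient.quot (bounded X Y n))%qT (q : hom_cocomplex X Y n) /\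
    coclass z = b.

Section StableProjection.
Variables (X Y : complex C) (n : int).
Implicit Types p q : cochain X Y n.

Lemma stable_eq p q :
  \pi_(Quotient.quot (bounded X Y n))%qT (p : hom_cocomplex X Y n) =
  \pi_(Quotient.quot (bounded X Y n))%qT (q : hom_cocomplex X Y n) <->
  p - q \in bounded X Y n.
Proof. by split=> [/eqP|h]; last apply/eqP; rewrite -Quotient.idealrBE. Qed.

Lemma stable_eq0 q :
  \pi_(Quotient.quot (bounded X Y n))%qT (q : hom_cocomplex X Y n) = 0 <->
  q \in bounded X Y n.
Proof.
rewrite -[q in q \in _]subr0 -stable_eq.
by rewrite [X in _ <-> _ = X](raddf0 \pi_(Quotient.quot (bounded X Y n))%qT).
Qed.

End StableProjection.

Lemma stable_codE X Y n m (q : cochain X Y n) :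
  cod (stable_hom X Y) n m
    (\pi_(Quotient.quot (bounded X Y n))%qT (q : hom_cocomplex X Y n)) =
  \pi_(Quotient.quot (bounded X Y m))%qT
    (hom_cod_fun m q : hom_cocomplex X Y m).
Proof. exact: (quot_mapE (@bounded_cod C X Y n m)). Qed.

Section Represents.
Variables (X Y : complex C) (n : int).
Implicit Types (p q : cochain X Y n) (b : cohomology (stable_hom X Y) n).

Lemma represents_total q : hom_cod_fun (n + 1) q \in bounded X Y (n + 1) ->
  exists b, represents q b.
Proof.
move=> hq; have hk : \pi_(Quotient.quot (bounded X Y n))%qT
    (q : hom_cocomplex X Y n) \in ker_pred (cod (stable_hom X Y) n (n + 1)).
  by rewrite unfold_in; apply/eqP; rewrite stable_codE; exact/stable_eq0.
pose z : cocycle (stable_hom X Y) n := Kernel hk.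
by exists (coclass z), z.
Qed.

Lemma represents_cod q b : represents q b ->
  hom_cod_fun (n + 1) q \in bounded X Y (n + 1).
Proof.
by move=> [z [hz _]]; have := cocycleP z; rewrite hz stable_codE => /stable_eq0.
Qed.

Lemma represents_surj b : exists q, represents q b.
Proof.
pose z : cocycle (stable_hom X Y) n := repr b.
by exists (repr (val z)), z; split; [rewrite reprK|exact: reprK].
Qed.

Lemma represents_eq0 q b : represents q b -> b = 0 <-> null q.
Proof.
move=> [z [hz <-]]; rewrite /coclass subquot_class_eq0 hz; split=> [[u]|[h hq]].
  rewrite -[u]reprK stable_codE => /esym/stable_eq hu.
  by exists (repr u).
exists (\pi_(Quotient.quot (bounded X Y (n - 1)))%qT
  (h : hom_cocomplex X Y (n - 1))).
by rewrite stable_codE; exact/esym/stable_eq.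
Qed.

Lemma representsB p q b b' :
  represents p b -> represents q b' -> represents (p - q) (b - b').
Proof.
move=> [z [hz <-]] [z' [hz' <-]]; exists (z - z').
split; last by rewrite /coclass raddfB.
have -> : val (z - z') = val z - val z' by [].
by rewrite hz hz'; apply/esym; exact: raddfB.
Qed.

Lemma represents_eq p q b b' :
  represents p b -> represents q b' -> b = b' <-> null (p - q).
Proof.
move=> hp hq; rewrite -(represents_eq0 (representsB hp hq)).
by split=> [->|/eqP]; rewrite ?subrr // subr_eq0 => /eqP.
Qed.

Lemma represents_null p q b : represents p b -> null (p - q) -> represents q b.
Proof.
move=> hp hpq; suff /represents_total[b' hq] :
    hom_cod_fun (n + 1) q \in bounded X Y (n + 1).
  by have := (represents_eq hp hq).2 hpq => ->.
have [h hh] := hpq; have := bounded_cod (n + 1) hh.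
have -> : cod (hom_cocomplex X Y) n (n + 1) (p - q - hom_cod_fun n h) =
    hom_cod_fun (n + 1) p - hom_cod_fun (n + 1) q.
  by rewrite [LHS]/= !raddfB /= hom_cod_cod subr0.
move=> hb; rewrite -[hom_cod_fun _ q](subKr (hom_cod_fun (n + 1) p)).
by rewrite rpredB // (represents_cod hp).
Qed.

End Represents.

Lemma represents_precomp X' X Y n (u : chain_map X' X) (q : cochain X Y n) b :
  represents q b ->
  represents (hcomp n q (chain_cochain u))
    (cohomology_map (stable_precomp Y u) n b).
Proof.
move=> [z [hz <-]]; rewrite cohomology_mapE.
exists (cocycle_map (stable_precomp Y u) z).
rewrite [val _]/(quot_map (@bounded_precomp C X' X Y u n) (val z)).
rewrite hz hcomp_chainr; split=> //.
exact: (quot_mapE (@bounded_precomp C X' X Y u n)).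
Qed.

Lemma represents_postcomp X Y Y' n (u : chain_map Y Y') (q : cochain X Y n) b :
  represents q b ->
  represents (hcomp n (chain_cochain u) q)
    (cohomology_map (stable_postcomp X u) n b).
Proof.
move=> [z [hz <-]]; rewrite cohomology_mapE.
exists (cocycle_map (stable_postcomp X u) z).
rewrite [val _]/(quot_map (@bounded_postcomp C X Y Y' u n) (val z)).
rewrite hz hcomp_chainl; split=> //.
exact: (quot_mapE (@bounded_postcomp C X Y Y' u n)).
Qed.

Lemma represents_proj X Y n (p : cocycle (hom_cocomplex X Y) n) :
  represents (val p : cochain X Y n)
    (cohomology_map (stable_proj X Y) n (coclass p)).
Proof.
by rewrite cohomology_mapE; exists (cocycle_map (stable_proj X Y) p).
Qed.

Section Splice.
Variables (X' X Y : complex C) (t : cochain X' X 1) (n : int).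
Hypothesis ht : hom_cod_fun (1 + 1) t = 0.

Lemma splice_total (b : cohomology (stable_hom X Y) n) :
  exists b' : cohomology (stable_hom X' Y) (n + 1),
  exists2 q, represents q b & represents (hcomp (n + 1) q t) b'.
Proof.
have [q hq] := represents_surj b.
have [|b' hb'] := @represents_total X' Y (n + 1) (hcomp (n + 1) q t).
  by rewrite hcomp_cocycle //; exact/bounded_hcompl/(represents_cod hq).
by exists b', q.
Qed.

Definition splice_fun b := sval (cid (splice_total b)).

Lemma represents_splice_fun (q : cochain X Y n) b :
  represents q b -> represents (hcomp (n + 1) q t) (splice_fun b).
Proof.
move=> hq; have [q' hq' h] := svalP (cid (splice_total b)).
apply: represents_null h _; rewrite -hcompBl; apply: null_hcompl => //.
exact/(represents_eq hq' hq).
Qed.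

Fact splice_funB : zmod_morphism splice_fun.
Proof.
move=> b b'; have [q hq] := represents_surj b.
have [q' hq'] := represents_surj b'.
have h := represents_splice_fun (representsB hq hq').
have h' := representsB (represents_splice_fun hq) (represents_splice_fun hq').
by apply/(represents_eq h h'); rewrite hcompBl subrr; exact: null0.
Qed.

Definition splice : {additive cohomology (stable_hom X Y) n ->
    cohomology (stable_hom X' Y) (n + 1)} :=
  HB.pack splice_fun (GRing.isZmodMorphism.Build
    (cohomology (stable_hom X Y) n) (cohomology (stable_hom X' Y) (n + 1))
    splice_fun splice_funB).

Lemma represents_splice (q : cochain X Y n) b :
  represents q b -> represents (hcomp (n + 1) q t) (splice b).
Proof. exact: represents_splice_fun. Qed.

End Splice.

End StableClasses.

(** * Exactness in cochain form *)

Section DistinguishedTriangle.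
Variables (C : additive_category) (X1 X2 X3 Y : complex C).
Variables (i : cochain X1 X2 0) (p : cochain X2 X3 0) (t : cochain X3 X1 1).
Variables (m : cochain X1 X3 (-1)) (r : cochain X2 X1 0) (s : cochain X3 X2 0).
Hypotheses (i_cocycle : hom_cod_fun 1 i = 0) (p_cocycle : hom_cod_fun 1 p = 0).
Hypothesis t_cocycle : hom_cod_fun 2 t = 0.
Hypotheses (m_cod : hom_cod_fun 0 m = hcomp 0 p i)
  (s_cod : hom_cod_fun 1 s = hcomp 1 i t)
  (r_cod : hom_cod_fun 1 r = - hcomp 1 t p).

Let id1 := chain_cochain (id_chain X1).
Let id2 := chain_cochain (id_chain X2).
Let id3 := chain_cochain (id_chain X3).
Hypotheses
  (htpy1 : exists k : cochain X1 X1 (-1),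
     hcomp 0 r i - hcomp 0 t m - id1 = hom_cod_fun 0 k)
  (htpy2 : exists k : cochain X2 X2 (-1),
     hcomp 0 s p + hcomp 0 i r - id2 = hom_cod_fun 0 k)
  (htpy3 : exists k : cochain X3 X3 (-1),
     hcomp 0 p s - hcomp 0 m t - id3 = hom_cod_fun 0 k).

Lemma triangle_exact2 n (f : cochain X2 Y n) :
    hom_cod_fun (n + 1) f \in bounded X2 Y (n + 1) -> null (hcomp n f i) ->
  exists g : cochain X3 Y n, hom_cod_fun (n + 1) g \in bounded X3 Y (n + 1) /\
    null (hcomp n g p - f).
Proof.
move=> hf [h hb]; have hfi := subrK (hom_cod_fun n h) (hcomp n f i).
set b := hcomp n f i - _ in hb hfi.
exists (hcomp n f s - hcomp n h t *~ (-1) ^ n); split.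
  rewrite raddfB raddfMz /= (@leibniz _ _ _ _ n 0 n (n + 1) 1) //; last lia.
  rewrite (@leibniz _ _ _ _ (n - 1) 1 n n 2) //; [|lia..].
  rewrite t_cocycle raddf0 mul0rz addr0 s_cod.
  rewrite -(@hcompA _ _ _ _ _ n 0 1 n 1) ?addr0 // -hfi hcompDl mulrzDl.
  by rewrite -addrA addrK rpredD ?rpredMz ?bounded_hcompl.
have [k hk] := htpy2.
have hD : hom_cod_fun n (hcomp (n - 1) h r) =
    hcomp n (hom_cod_fun n h) r + hcomp n (hcomp n h t) p *~ (-1) ^ n.
  rewrite (@leibniz _ _ _ _ (n - 1) 0 (n - 1) n 1) //; [|lia..].
  rewrite r_cod raddfN /= sign_pred mulrNz mulNrz opprK.
  by rewrite (@hcompA _ _ _ _ _ (n - 1) 1 0 n 1) //; lia.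
have -> : hcomp n (hcomp n f s - hcomp n h t *~ (-1) ^ n) p - f =
    hcomp n f (hom_cod_fun 0 k) -
    (hcomp n b r + hom_cod_fun n (hcomp (n - 1) h r)).
  rewrite hD addrA -hcompDl hfi -hk raddfB raddfD /= hcomp_id hcompBl hcompZl.
  rewrite !(@hcompA _ _ _ _ _ n 0 0 n 0) ?addr0 //.
  set c := hcomp n f (hcomp 0 i r).
  by rewrite (opprD c) (addrA _ (- c)) (addrAC _ c) addrK addrAC.
apply: nullB; first by apply: null_hcompr => //; lia.
by apply: nullD; [exact/null_bounded/bounded_hcompl|exact: null_cod].
Qed.

Lemma triangle_exact1 n (f : cochain X1 Y n) :
    hom_cod_fun (n + 1) f \in bounded X1 Y (n + 1) ->
    null (hcomp (n + 1) f t) ->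
  exists g : cochain X2 Y n, hom_cod_fun (n + 1) g \in bounded X2 Y (n + 1) /\
    null (hcomp n g i - f).
Proof.
move=> hf /(nullP _ (erefl (n + 1)))[h hb].
have hft := subrK (hom_cod_fun (n + 1) h) (hcomp (n + 1) f t).
set b := hcomp _ f t - _ in hb hft.
exists (hcomp n f r + hcomp n h p *~ (-1) ^ n); split.
  rewrite raddfD raddfMz /= (@leibniz _ _ _ _ n 0 n (n + 1) 1) ?addr0 //.
  rewrite (@leibniz _ _ _ _ n 0 n (n + 1) 1) ?addr0 //.
  rewrite p_cocycle raddf0 mul0rz addr0 r_cod raddfN /= mulNrz.
  rewrite -(@hcompA _ _ _ _ _ n 1 0 (n + 1) 1) // -hft hcompDl mulrzDl opprD.
  by rewrite -!addrA addNr addr0 rpredB ?rpredMz ?bounded_hcompl.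
have [k hk] := htpy1.
have hD : hom_cod_fun n (hcomp (n - 1) h m) =
    hcomp n (hom_cod_fun (n + 1) h) m + hcomp n (hcomp n h p) i *~ (-1) ^ n.
  rewrite (@leibniz _ _ _ _ n (-1) (n - 1) (n + 1) 0) //; last lia.
  by rewrite m_cod (@hcompA _ _ _ _ _ n 0 0 n 0) ?addr0.
have -> : hcomp n (hcomp n f r + hcomp n h p *~ (-1) ^ n) i - f =
    hcomp n f (hom_cod_fun 0 k) +
    (hcomp n b m + hom_cod_fun n (hcomp (n - 1) h m)).
  rewrite hD (addrA (hcomp n b m)) -hcompDl hft -hk !raddfB /= hcomp_id.
  rewrite hcompDl hcompZl.
  rewrite (@hcompA _ _ _ _ _ n 0 0 n 0) ?addr0 //.
  rewrite (@hcompA _ _ _ _ _ n 1 (-1) (n + 1) 0) ?addr0 //.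
  by rewrite [X in _ = X + _]addrAC [RHS]addrA subrK addrAC.
apply: nullD; first by apply: null_hcompr => //; lia.
by apply: nullD; [exact/null_bounded/bounded_hcompl|exact: null_cod].
Qed.

Lemma triangle_exact3 n (f : cochain X3 Y (n + 1)) :
    hom_cod_fun (n + 1 + 1) f \in bounded X3 Y (n + 1 + 1) ->
    null (hcomp (n + 1) f p) ->
  exists g : cochain X1 Y n, hom_cod_fun (n + 1) g \in bounded X1 Y (n + 1) /\
    null (hcomp (n + 1) g t - f).
Proof.
move=> hf /(nullP _ (erefl (n + 1)))[h hb].
have hfp := subrK (hom_cod_fun (n + 1) h) (hcomp (n + 1) f p).
set b := hcomp _ f p - _ in hb hfp.
exists (- (hcomp n h i *~ (-1) ^ n) - hcomp n f m); split.
  rewrite raddfB raddfN raddfMz /= (@leibniz _ _ _ _ n 0 n (n + 1) 1) ?addr0 //.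
  rewrite (@leibniz _ _ _ _ (n + 1) (-1) n (n + 1 + 1) 0) //; last lia.
  rewrite i_cocycle raddf0 mul0rz addr0 m_cod sign_succ mulrNz opprB.
  rewrite -(@hcompA _ _ _ _ _ (n + 1) 0 0 (n + 1) 0) ?addr0 // -hfp hcompDl.
  rewrite mulrzDl (addrC (_ *~ _) (_ *~ _)) -[_ + _ - _]addrA addKr.
  by rewrite rpredB ?rpredMz ?bounded_hcompl.
have [k hk] := htpy3.
have hD : hom_cod_fun (n + 1) (hcomp n h s) =
    hcomp (n + 1) (hom_cod_fun (n + 1) h) s +
    hcomp (n + 1) (hcomp n h i) t *~ (-1) ^ n.
  rewrite (@leibniz _ _ _ _ n 0 n (n + 1) 1) ?addr0 //.
  by rewrite s_cod (@hcompA _ _ _ _ _ n 0 1 n 1) ?addr0.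
have -> : hcomp (n + 1) (- (hcomp n h i *~ (-1) ^ n) - hcomp n f m) t - f =
    hcomp (n + 1) f (hom_cod_fun 0 k)
    - (hcomp (n + 1) b s + hom_cod_fun (n + 1) (hcomp n h s)).
  rewrite hD addrA -hcompDl hfp -hk !raddfB /= hcomp_id hcompBl -mulNrz hcompZl.
  rewrite (@hcompA _ _ _ _ _ (n + 1) 0 0 (n + 1) 0) ?addr0 //.
  rewrite (@hcompA _ _ _ _ _ (n + 1) (-1) 1 n 0) ?addrK ?addr0 //.
  set u := hcomp _ f (hcomp 0 p s); set v := hcomp _ f (hcomp 0 m t).
  rewrite hcompNl mulNrz (opprD u) -!addrA (addrCA (- f)) (addrCA (- v)) addNKr.
  by rewrite addrC -addrA.
apply: nullB; first by apply: null_hcompr => //; lia.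
by apply: nullD; [exact/null_bounded/bounded_hcompl|exact: null_cod].
Qed.

End DistinguishedTriangle.
(** * The cocycle of a triangle *)

Section Connecting.
Variables (C : extriangulated) (xi : triangle_class C).

Lemma null_homotopy M (P : complex C) (Q : resolution xi M) (n m : int)
    (c : cochain P Q m) (g : mor (P n) M) : (forall i, projective xi (P i)) ->
    m = n + 1 -> hom_cod_fun (m + 1) c = 0 ->
    aug Q \oc entry m 0 c = - (g \oc diff P m n) *~ (-1) ^ n ->
  exists h : cochain P Q n, hom_cod_fun m h = c.
Proof.
by move=> hP hm hc hg; have [h []] := acyclic_lift hP hm hc hg; exists h.
Qed.

Lemma null_homotopy0 M (P : complex C) (Q : resolution xi M)
    (c : cochain P Q 0) : (forall i, projective xi (P i)) ->
    hom_cod_fun 1 c = 0 ->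
    aug Q \oc entry 0 0 c = 0 ->
  exists h : cochain P Q (-1), c = hom_cod_fun 0 h.
Proof.
move=> hP hc h0; have [|h <-] := @null_homotopy M P Q (-1) 0 c 0 hP erefl hc.
  by rewrite h0 comp0m oppr0 mul0rz.
by exists h.
Qed.

Lemma aug_d10 M (P : resolution xi M) : aug P \oc diff P 1 0 = 0.
Proof. exact: aug_d. Qed.

Lemma resolution_neg M (P : resolution xi M) (i : int) N (h : mor (P i) N) :
  i < 0 -> h = 0.
Proof.
by move=> hi; have [neg _ _] := resP P; rewrite -[h]compm1 neg ?compm0.
Qed.

Section Triangle.
Variables (A B X : C) (x : mor A B) (y : mor B X) (e : exE C X A).
Hypothesis hx : xi x y e.

Lemma triangle_lift W (h : mor W X) : projective xi W -> exists k, y \oc k = h.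
Proof. by move=> hW; have [_ _ /(_ h)] := hW _ _ _ _ _ _ hx. Qed.

Lemma triangle_ker W (h : mor W B) : projective xi W -> y \oc h = 0 ->
  exists k, x \oc k = h.
Proof. by move=> hW; have [_ ex _] := hW _ _ _ _ _ _ hx; move/ex. Qed.

Lemma triangle_mono W (h h' : mor W A) : projective xi W ->
  x \oc h = x \oc h' -> h = h'.
Proof. by move=> hW; have [inj _ _] := hW _ _ _ _ _ _ hx; move/inj. Qed.

Lemma triangle_comp W (h : mor W A) : projective xi W -> y \oc (x \oc h) = 0.
Proof.
by move=> hW; have [_ ex _] := hW _ _ _ _ _ _ hx; apply/ex; exists h.
Qed.

End Triangle.

(* Up to sign, aug P \oc t is the restriction to P''_1 of a lift P''_0 -> B   *)
(* of the augmentation; t represents the triangle in Ext^1(X, A).             *)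
Definition ext_cocycle (A B X : C) (x : mor A B) (y : mor B X)
    (P : resolution xi A) (P'' : resolution xi X) (t : cochain P'' P 1) :
    Prop :=
  hom_cod_fun 2 t = 0 /\ exists l : mor (P'' 0) B,
    y \oc l = aug P'' /\ x \oc (aug P \oc entry 1 0 t) = - (l \oc diff P'' 1 0).

Lemma ext_cocycle_exists (A B X : C) (x : mor A B) (y : mor B X) (e : exE C X A)
    (P : resolution xi A) (P'' : resolution xi X) : xi x y e ->
  exists t, @ext_cocycle A B X x y P P'' t.
Proof.
move=> hx; have pr := resolution_projective P''.
have [l hl] := triangle_lift hx (aug P'') (pr 0).
have [|f hf] := triangle_ker hx (h := - (l \oc diff P'' 1 0)) (pr 1).
  by rewrite compNr Defs.compA hl aug_d10 oppr0.
have [|t [ht htf]] := @cochain_lift C xi P'' A P 1 pr f.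
  apply: (triangle_mono hx (pr _)).
  by rewrite Defs.compA hf compNl -Defs.compA d_d !compm0 oppr0.
by exists t; split=> //; exists l; rewrite -hf -htf.
Qed.

Lemma ext_cocycle_natural (A B X : C) (x : mor A B) (y : mor B X)
    (A' B' X' : C) (x' : mor A' B') (y' : mor B' X') (e' : exE C X' A')
    (a : mor A A') (b : mor B B') (c : mor X X')
    (P : resolution xi A) (P'' : resolution xi X) (t : cochain P'' P 1)
    (Q : resolution xi A') (Q'' : resolution xi X') (t' : cochain Q'' Q 1)
    (u : chain_map P Q) (w : chain_map P'' Q'') :
    xi x' y' e' -> b \oc x = x' \oc a -> c \oc y = y' \oc b ->
    ext_cocycle x y t -> ext_cocycle x' y' t' -> is_lift a u -> is_lift c w ->
  exists h : cochain P'' Q 0, hom_cod_fun 1 h =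
    hcomp 1 (chain_cochain u) t - hcomp 1 t' (chain_cochain w).
Proof.
move=> hx' hab hbc [ht [l [hl htl]]] [ht' [l' [hl' htl']]] hu hw.
have pr := resolution_projective P''.
have [|g hg] := triangle_ker hx' (h := b \oc l - l' \oc w 0) (pr 0).
  by rewrite compBr !Defs.compA -hbc hl' -Defs.compA hl -hw subrr.
apply: (null_homotopy (g := g)) => //.
  rewrite raddfB /= (@leibniz _ _ _ _ 0 1 1 1 2) //.
  rewrite (@leibniz _ _ _ _ 1 0 1 2 1) // ht ht' !chain_cochain_cocycle.
  by rewrite !raddf0 !hcomp0l !mul0rz !addr0 subrr.
rewrite expr0z mulr1z; apply: (triangle_mono hx' (pr 1)).
have h1 : x' \oc (aug Q \oc (u 0 \oc entry 1 0 t)) =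
    - (b \oc l \oc diff P'' 1 0).
  rewrite [aug Q \oc _]Defs.compA hu -Defs.compA Defs.compA -hab -Defs.compA.
  by rewrite htl compNr Defs.compA.
have h2 : x' \oc (aug Q \oc (entry 1 0 t' \oc w 1)) =
    - (l' \oc w 0 \oc diff P'' 1 0).
  rewrite [aug Q \oc _]Defs.compA Defs.compA htl' compNl -!Defs.compA.
  by rewrite -chmapC.
rewrite entryBE entry_hcomp_chainl entry_hcomp_chainr !compBr h1 h2.
by rewrite compNr (Defs.compA x') hg compBl opprB opprK addrC.
Qed.

Section Homotopies.
Variables (A B X : C) (x : mor A B) (y : mor B X) (e : exE C X A).
Variables (P : resolution xi A) (Q : resolution xi B) (R : resolution xi X).
Variables (i : chain_map P Q) (p : chain_map Q R) (t : cochain R P 1).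
Hypotheses (hx : xi x y e) (hi : is_lift x i) (hp : is_lift y p).
Hypothesis ht : ext_cocycle x y t.

Let I := chain_cochain i.
Let J := chain_cochain p.

Lemma triangle_homotopies : exists (m : cochain P R (-1)) (r : cochain Q P 0)
  (s : cochain R Q 0),
  [/\ [/\ hom_cod_fun 0 m = hcomp 0 J I, hom_cod_fun 1 s = hcomp 1 I t &
      hom_cod_fun 1 r = - hcomp 1 t J],
   exists k : cochain P P (-1),
     hcomp 0 r I - hcomp 0 t m - chain_cochain (id_chain P) = hom_cod_fun 0 k,
   exists k : cochain Q Q (-1),
     hcomp 0 s J + hcomp 0 I r - chain_cochain (id_chain Q) = hom_cod_fun 0 k &
   exists k : cochain R R (-1),
     hcomp 0 J s - hcomp 0 m t - chain_cochain (id_chain R) = hom_cod_fun 0 k].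
Proof.
have prP := resolution_projective P; have prQ := resolution_projective Q.
have prR := resolution_projective R.
have [ht2 [l [hl htl]]] := ht.
have hI n : hom_cod_fun n I = 0 := chain_cochain_cocycle i n.
have hJ n : hom_cod_fun n J = 0 := chain_cochain_cocycle p n.
have [||m /esym hm] := @null_homotopy0 _ P R (hcomp 0 J I) prP.
- by rewrite (@leibniz _ _ _ _ 0 0 0 1 1) // hI hJ raddf0 hcomp0l mul0rz addr0.
- rewrite entry_hcomp_chainl entry_chain Defs.compA hp -Defs.compA hi.
  by apply: (triangle_comp hx); exact: prP.
have [||s [hs hs0]] := @acyclic_lift _ _ R _ Q 0 1 prR (hcomp 1 I t) l erefl.
- rewrite (@leibniz _ _ _ _ 0 1 1 1 2) // hI ht2 raddf0 hcomp0l.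
  by rewrite mul0rz addr0.
- by rewrite entry_hcomp_chainl Defs.compA hi -Defs.compA htl mulr1z.
have [|g hg] := triangle_ker hx (h := aug Q - l \oc p 0) (prQ 0).
  by rewrite compBr Defs.compA hl hp subrr.
have [||r [hr hr0]] := @acyclic_lift _ _ Q _ P 0 1 prQ (- hcomp 1 t J) g erefl.
- rewrite raddfN /= (@leibniz _ _ _ _ 1 0 1 2 1) // hJ ht2 raddf0 hcomp0l.
  by rewrite mul0rz addr0 oppr0.
- rewrite mulr1z; apply: (triangle_mono hx (prQ 1)).
  rewrite entryNE entry_hcomp_chainr !compNr (Defs.compA x g) hg compBl aug_d10.
  by rewrite sub0r -Defs.compA chmapC !Defs.compA -(Defs.compA x) htl compNl.
have hm0 : p 0 \oc i 0 = diff R 1 0 \oc entry 0 1 m.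
  have := @entry_cod _ _ _ _ 0 m 0 0 erefl erefl.
  rewrite hm entry_hcomp_chainl entry_chain.
  by rewrite [entry (0 - 1) 0 m](resolution_neg _) // comp0m mul0rz subr0.
have hN T n : hom_cod_fun n (chain_cochain (id_chain T)) = 0 :=
  chain_cochain_cocycle (id_chain T) n.
exists m, r, s; split=> //.
- apply: null_homotopy0 => //.
    rewrite !raddfB /= hN subr0 (@leibniz _ _ _ _ 0 0 0 1 1) // hr hI.
    rewrite raddf0 mul0rz addr0 (@leibniz _ _ _ _ 1 (-1) 0 2 0) // ht2 hm.
    rewrite hcomp0l add0r expr1z mulrN1z opprK hcompNl.
    by rewrite (@hcompA _ _ _ _ _ 1 0 0 1 0) // addNr.
  apply: (triangle_mono hx (prP 0)).
  rewrite !entryBE entry_hcomp_chainr entry_chain !compBr compm1 compm0.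
  rewrite (@entry_hcomp _ _ _ _ 1 (-1) 0 t m 0 1 0) //.
  rewrite (Defs.compA _ _ (i 0)) hr0 (Defs.compA x g) hg.
  rewrite (Defs.compA _ _ (entry 0 1 m)) (Defs.compA x _ (entry 0 1 m)) htl.
  rewrite compNl opprK compBl.
  by rewrite hi -!Defs.compA hm0 subrK subrr.
- apply: null_homotopy0 => //.
    rewrite raddfB raddfD /= hN subr0 (@leibniz _ _ _ _ 0 0 0 1 1) // hs hJ.
    rewrite raddf0 mul0rz addr0 (@leibniz _ _ _ _ 0 0 0 1 1) // hI hr.
    rewrite hcomp0l add0r expr0z mulr1z hcompNr.
    by rewrite (@hcompA _ _ _ _ _ 0 1 0 1 1) // subrr.
  rewrite entryBE entryDE entry_hcomp_chainr entry_hcomp_chainl entry_chain.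
  rewrite compBr compDr compm1 !Defs.compA hs0 hi -Defs.compA hr0 hg.
  by rewrite [_ + (_ - _)]addrC subrK subrr.
- apply: null_homotopy0 => //.
    rewrite !raddfB /= hN subr0 (@leibniz _ _ _ _ 0 0 0 1 1) // hs hJ.
    rewrite hcomp0l add0r expr0z mulr1z (@leibniz _ _ _ _ (-1) 1 0 0 2) //.
    rewrite ht2 hm raddf0 mul0rz addr0.
    by rewrite (@hcompA _ _ _ _ _ 0 0 1 0 1) // subrr.
  rewrite !entryBE entry_hcomp_chainl entry_chain !compBr compm1.
  rewrite (@entry_hcomp _ _ _ _ (-1) 1 0 m t 0 (-1) 0) //.
  rewrite [entry (-1) 0 m](resolution_neg _) // comp0m compm0 subr0.
  by rewrite Defs.compA hp -Defs.compA hs0 hl subrr.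
Qed.

End Homotopies.
End Connecting.

Lemma cohomology_surj (K : cocomplex) n (a : cohomology K n) :
  exists z : cocycle K n, coclass z = a.
Proof. by exists (repr a); exact: reprK. Qed.

(** * Comparison maps and horseshoes *)

Section Comparison.
Variables (C : extriangulated) (xi : triangle_class C).
Variables (M N : C) (P : resolution xi M) (Q : resolution xi N).

Lemma cochain_lift_null (T : complex C) n (p p' : cochain T Q n)
    (z z' : cocycle (homto T N) n) : (forall i, projective xi (T i)) ->
    hom_cod_fun (n + 1) p = 0 -> hom_cod_fun (n + 1) p' = 0 ->
    aug Q \oc entry n 0 p = val z -> aug Q \oc entry n 0 p' = val z' ->
  coclass z = coclass z' -> null (p - p').
Proof.
move=> hT hp hp' hz hz' /coclass_eq[g hg].
have hn : n = n - 1 + 1 by rewrite subrK.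
have [||h <-] := @null_homotopy C xi _ T Q (n - 1) n (p - p')
  (- (g : mor (T (n - 1)) N) *~ (-1) ^ (n - 1)) hT hn.
- by rewrite raddfB /= hp hp' subrr.
- rewrite entryBE compBr hz hz' -hg compZl compNl.
  by rewrite !mulNrz opprK -mulrzA sign_sqr mulr1z.
exact: null_cod.
Qed.

Lemma stable_precomp_inj (T : complex C) (u : chain_map T P) n
    (q q' : cochain P Q n) (b b' : cohomology (stable_hom P Q) n) :
    (exists m : int, forall i, m <= i -> is_id (u i)) ->
    represents q b -> represents q' b' ->
    cohomology_map (stable_precomp Q u) n b =
    cohomology_map (stable_precomp Q u) n b' -> b = b'.
Proof.
move=> [m hm] hq hq' e; apply/(represents_eq hq hq').
have /represents_eq/(_ (represents_precomp u hq')) := represents_precomp u hq.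
move/proj1/(_ e); rewrite -hcompBl => -[h hh].
have /choice_dep[c hc] : forall i, exists c : forall j, mor (P i) (Q j),
    forall j, (i != j + (n - 1) -> c j = 0) /\
      (m <= i -> c j \oc u i = entry i j h).
  move=> i; apply: (@choice_dep int (fun j => mor (P i) (Q j)) (fun j c =>
    (i != j + (n - 1) -> c = 0) /\ (m <= i -> c \oc u i = entry i j h))) => j.
  have [hij|hij] := eqVneq i (j + (n - 1)); last first.
    by exists 0; split=> // _; rewrite comp0m entry_shape.
  have [hi|hi] := leP m i; last by exists 0; split.
  by have [c hc] := is_id_factor (entry i j h) (hm i hi); exists c.
have hcd : (c : bifamily _) \in degree_pred P Q (n - 1).
  by apply/asboolP => i j ij; have [-> //] := hc i j.
pose k : cochain P Q (n - 1) := Cochain hcd; exists k.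
have kE i j : m <= i -> entry i j k \oc u i = entry i j h := (hc i j).2.
have /boundedP[m' hm'] := hh.
apply/boundedP; exists (Num.max m' (m + 1)) => i j.
rewrite ge_max => /andP[hi' hi].
have hi0 : m <= i by lia.
have hi1 : m <= i - 1 by lia.
apply: (is_id_epi (hm i hi0)); rewrite -(hm' i j hi').
have [hij|hij] := eqVneq i (j + n); last by rewrite !entry_shape // comp0m.
rewrite !entryBE entry_hcomp_chainr entryBE !compBl; congr (_ - _).
rewrite !entry_cod ?subrK // compBl compZl -!Defs.compA -chmapC.
by rewrite kE // (Defs.compA (entry (i - 1) j k)) kE.
Qed.

Lemma represents_comparison (T : complete_resolution P) n
    (z : cocycle (homto P N) n) (p : cochain P Q n) :
    hom_cod_fun (n + 1) p = 0 -> aug Q \oc entry n 0 p = val z ->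
  represents p (comparison_map Q T (coclass z)).
Proof.
move=> hp hz; rewrite /comparison_map cohomology_mapE.
set z' := cocycle_map _ z.
have [w [v [hw hv hb]]] := svalP (cid (identification_total Q (coclass z'))).
set b := identification _ _.
have [|b' hb'] := @represents_total _ _ _ n p; first by rewrite hp rpred0.
suff -> : b = b' by [].
have [q hq] := represents_surj b.
apply: (stable_precomp_inj (cr_id T) hq hb'); rewrite hb.
apply/(represents_eq (represents_proj v) (represents_precomp (cr_map T) hb')).
have [K [projT _]] := cr_complete T.
apply: (cochain_lift_null projT _ _ hv _ hw).
- exact: (cocycleP v).
- by rewrite hcomp_cocycle ?chain_cochain_cocycle ?addr0 // hp hcomp0l.
- by rewrite entry_hcomp_chainr Defs.compA hz.
Qed.

End Comparison.

Section HorseshoeCocycle.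
Variables (C : extriangulated) (xi : triangle_class C).
Variables (A B X : C) (x : mor A B) (y : mor B X).
Variables (P : resolution xi A) (R : resolution xi X) (H : horseshoe x y P R).

Lemma horseshoe_cocycle : exists t : cochain R P 1, ext_cocycle x y t /\
  forall N n (z : cocycle (homto P N) n) (z' : cocycle (homto R N) (n + 1)),
    val z' = (val z : mor (P n) N) \oc entry (n + 1) n t ->
    ext_connecting H (coclass z) = coclass z'.
Proof.
have /choice_dep[s /choice_dep[r hrs]] := hs_split H.
have ri n : r n \oc hs_in H n = idm (P n) by case: (hrs n).
have os n : hs_out H n \oc s n = idm (R n) by case: (hrs n).
have irso n : hs_in H n \oc r n + s n \oc hs_out H n = idm (hs_mid H n).
  by case: (hrs n).
have hd : (fun i j => r j \oc diff H i j \oc s i) \in degree_pred R P 1.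
  by apply/asboolP => i j hij; rewrite d_shape // compm0 comp0m.
pose t : cochain R P 1 := Cochain hd.
have tE i j : entry i j t = r j \oc diff H i j \oc s i by [].
have ds i j : diff H i j \oc s i =
    hs_in H j \oc entry i j t + s j \oc diff R i j.
  rewrite tE -[LHS]comp1m -irso compDl -!Defs.compA; congr (_ + _ \oc _).
  by rewrite Defs.compA chmapC -Defs.compA os compm1.
have rd i j : r j \oc diff H i j =
    diff P i j \oc r i + entry i j t \oc hs_out H i.
  rewrite tE -[LHS]compm1 -irso compDr !Defs.compA; congr (_ \oc _ + _).
  by rewrite -Defs.compA -chmapC Defs.compA ri comp1m.
exists t; split=> [|N n z z' hz'].
  split.
    apply: entry_ext => i j hij.
    rewrite entry_cod // entry0E expr1z mulrN1z opprK.
    have : r j \oc (diff H (j + 1) j \oc diff H i (j + 1)) \oc s i = 0.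
      by rewrite d_d compm0 comp0m.
    rewrite -!Defs.compA ds compDr Defs.compA compDr => <-; congr (_ + _).
      rewrite !Defs.compA -[r j \oc _ \oc _]Defs.compA -chmapC Defs.compA ri.
      by rewrite comp1m.
    by rewrite -(_ : j + 1 = i - 1) ?tE ?Defs.compA //; lia.
  exists (aug H \oc s 0); split.
    by rewrite Defs.compA -(hs_lift_out H) -Defs.compA os compm1.
  have := congr1 (fun h => aug H \oc h) (ds 1 0).
  rewrite /= Defs.compA aug_d10 comp0m.
  move/esym/eqP; rewrite compDr addr_eq0 => /eqP; rewrite !Defs.compA => <-.
  by rewrite (hs_lift_in H).
apply: (connecting_functional (horseshoe_exact H N) (a := coclass z)).
  exact: svalP (cid (connecting_total (horseshoe_exact H N) (coclass z))).
exists z, ((val z : mor (P n) N) \oc r n), z'; split=> //.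
  by rewrite /= /precomp -Defs.compA ri compm1.
have hz : (val z : mor (P n) N) \oc diff P (n + 1) n = 0 := cocycleP z.
rewrite /= /precomp -Defs.compA rd compDr Defs.compA hz comp0m add0r.
by rewrite Defs.compA -hz'.
Qed.

End HorseshoeCocycle.

Lemma res_lift_lift (C : extriangulated) (xi : triangle_class C) (M M' : C)
    (f : mor M M') (P : resolution xi M) (P' : resolution xi M') :
  is_lift f (res_lift f P P').
Proof. exact: svalP (cid (lift_exists f P P')). Qed.

Section LongExactSequence.
Variables (C : extriangulated) (xi : triangle_class C).
Variable R : forall M : C, resolution xi M.
Variables (A B X : C) (x : mor A B) (y : mor B X) (e : exE C X A).
Hypothesis hx : xi x y e.
Variable t : cochain (R X) (R A) 1.
Hypotheses (ht : hom_cod_fun (1 + 1) t = 0) (hxt : ext_cocycle x y t).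
Variables (N : C) (n : int).

Lemma cxt_long_exact :
  [/\ exact_at (cxt_mapl R n y N) (cxt_mapl R n x N),
      exact_at (cxt_mapl R n x N) (splice (R N) n ht) &
      exact_at (splice (R N) n ht) (cxt_mapl R (n + 1) y N)].
Proof.
have [m [r [s [[hm hs hr] k1 k2 k3]]]] := triangle_homotopies hx
  (res_lift_lift x (R A) (R B)) (res_lift_lift y (R B) (R X)) hxt.
set i := res_lift x _ _ in hm hs k1 k2; set p := res_lift y _ _ in hm hr k2 k3.
have hi := chain_cochain_cocycle i; have hp := chain_cochain_cocycle p.
split=> v.
- split=> [|[u <-]].
    have [f hf] := represents_surj v.
    move/(represents_eq0 (represents_precomp i hf)) => h0.
    have [g [hg hgf]] := triangle_exact2 ht hs hr k2 (represents_cod hf) h0.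
    have [u hu] := represents_total hg; exists u.
    exact/(represents_eq (represents_precomp p hu) hf).
  have [g hg] := represents_surj u.
  apply/(represents_eq0 (represents_precomp i (represents_precomp p hg))).
  rewrite (@hcompA _ _ _ _ _ n 0 0 n 0) ?addr0 // -hm.
  by apply: null_hcompr; rewrite ?addr0 ?(represents_cod hg).
- split=> [|[u <-]].
    have [f hf] := represents_surj v.
    move/(represents_eq0 (represents_splice ht hf)) => h0.
    have [g [hg hgf]] := triangle_exact1 (hp _) hm hr k1 (represents_cod hf) h0.
    have [u hu] := represents_total hg; exists u.
    exact/(represents_eq (represents_precomp i hu) hf).
  have [g hg] := represents_surj u.
  apply/(represents_eq0 (represents_splice ht (represents_precomp i hg))).
  rewrite (@hcompA _ _ _ _ _ n 0 1 n 1) ?addr0 // -hs.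
  by apply: null_hcompr; rewrite ?(represents_cod hg).
split=> [|[u <-]].
  have [f hf] := represents_surj v.
  move/(represents_eq0 (represents_precomp p hf)) => h0.
  have [g [hg hgf]] := triangle_exact3 (hi _) hm hs k3 (represents_cod hf) h0.
  have [u hu] := represents_total hg; exists u.
  exact/(represents_eq (represents_splice ht hu) hf).
have [g hg] := represents_surj u.
apply/(represents_eq0 (represents_precomp p (represents_splice ht hg))).
rewrite (@hcompA _ _ _ _ _ n 1 0 (n + 1) 1) ?addr0 // -[hcomp 1 _ _]opprK -hr.
by rewrite hcompNr; apply/nullN/null_hcompr; rewrite ?(represents_cod hg).
Qed.

End LongExactSequence.

Section Naturality.
Variables (C : extriangulated) (xi : triangle_class C).

Lemma aug_cocycle (N : C) (Q : resolution xi N) (T : complex C) n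
    (c : cochain T Q n) :
  hom_cod_fun (n + 1) c = 0 -> aug Q \oc entry n 0 c \oc diff T (n + 1) n = 0.
Proof.
move=> hc; have h : n + 1 = 0 + (n + 1) by rewrite add0r.
have := entry_cod c erefl h; rewrite hc entry0E addrK => /esym/eqP.
rewrite subr_eq0 => /eqP /(congr1 (fun f => aug Q \oc f *~ (-1) ^ n)).
rewrite compZr -mulrzA sign_sqr mulr1z -Defs.compA => <-.
by rewrite Defs.compA aug_d comp0m mul0rz.
Qed.

Lemma splice_comparison (A B X N : C) (x : mor A B) (y : mor B X)
    (e : exE C X A) (P : resolution xi A) (R : resolution xi X)
    (Q : resolution xi N) (t : cochain R P 1) (ht : hom_cod_fun (1 + 1) t = 0)
    (H : horseshoe x y P R) (TP : complete_resolution P)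
    (TR : complete_resolution R) n (a : cohomology (homto P N) n) :
    xi x y e -> ext_cocycle x y t ->
  splice Q n ht (comparison_map Q TP a) =
  comparison_map Q TR (ext_connecting H a).
Proof.
move=> hx hxt; have [z <-] := cohomology_surj a.
have [t' [ht' hconn]] := horseshoe_cocycle H.
have [q [hq hqz]] := cochain_lift Q (resolution_projective P) (cocycleP z).
have hqt : hom_cod_fun (n + 1 + 1) (hcomp (n + 1) q t') = 0.
  by rewrite hcomp_cocycle ?ht'.1 // hq hcomp0l.
have hz' : (aug Q \oc entry (n + 1) 0 (hcomp (n + 1) q t')
      : homto R N (n + 1)) \in ker_pred (cod (homto R N) (n + 1) (n + 1 + 1)).
  by rewrite unfold_in; apply/eqP; exact: aug_cocycle.
pose z' : cocycle (homto R N) (n + 1) := Kernel hz'.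
rewrite (hconn N n z z'); last first.
  rewrite -hqz [LHS]/(aug Q \oc entry (n + 1) 0 (hcomp (n + 1) q t')).
  rewrite (@entry_hcomp _ _ _ _ n 1 (n + 1) q t' (n + 1) n 0) //.
  exact: Defs.compA.
have h := represents_splice ht (represents_comparison TP hq hqz).
have h' := @represents_comparison _ _ _ _ _ Q TR _ z' _ hqt erefl.
apply/(represents_eq h h'); rewrite -raddfB /=.
have [k hk] := ext_cocycle_natural (a := idm A) (b := idm B) (c := idm X)
  (u := id_chain P) (w := id_chain R) hx
  (etrans (comp1m _) (esym (compm1 _))) (etrans (comp1m _) (esym (compm1 _)))
  hxt ht' (etrans (compm1 _) (esym (comp1m _)))
  (etrans (compm1 _) (esym (comp1m _))).
have -> : t - t' = hom_cod_fun 1 k.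
  rewrite hk hcomp_id hcomp_chainl; congr (_ - _).
  by apply: entry_ext => i j _; rewrite /entry /= comp1m.
by apply: null_hcompr => //; rewrite hq rpred0.
Qed.

Lemma connecting_cocycle_exists (A B X : C) (x : mor A B) (y : mor B X)
    (e : exE C X A) (P : resolution xi A) (R : resolution xi X) :
  exists t : cochain R P 1, hom_cod_fun (1 + 1) t = 0 /\
    (xi x y e -> ext_cocycle x y t).
Proof.
have [hx|hx] := pselect (xi x y e).
  by have [t ht] := ext_cocycle_exists P R hx; exists t; split; first case: ht.
by exists 0; split=> //; exact: raddf0.
Qed.

End Naturality.

Theorem theorem3p11 (C : extriangulated) (hW : WIC C) (xi : triangle_class C)
  (hxi : proper_class xi) (hP : enough_projectives xi)
  (hI : enough_injectives xi) (R : forall M : C, resolution xi M) :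
  exists dt : forall (A B X : C) (x : mor A B) (y : mor B X) (e : exE C X A)
      (N : C) (n : int), {additive cxt R n A N -> cxt R (n + 1) X N},
  [/\ (* the long exact sequence *)
      forall (A B X : C) (x : mor A B) (y : mor B X) (e : exE C X A),
        xi A B X x y e -> finite_Gpdim xi A -> finite_Gpdim xi X ->
        forall (N : C) (n : int),
        [/\ exact_at (cxt_mapl R n y N) (cxt_mapl R n x N),
            exact_at (cxt_mapl R n x N) (dt A B X x y e N n) &
            exact_at (dt A B X x y e N n) (cxt_mapl R (n + 1) y N)],
      (* naturality in N *)
      forall (A B X : C) (x : mor A B) (y : mor B X) (e : exE C X A),
        xi A B X x y e -> finite_Gpdim xi A -> finite_Gpdim xi X ->
        forall (N N' : C) (g : mor N N') (n : int) (b : cxt R n A N),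
        dt A B X x y e N' n (cxt_mapr R n A g b) =
        cxt_mapr R (n + 1) X g (dt A B X x y e N n b),
      (* naturality in the E-triangle *)
      forall (A B X : C) (x : mor A B) (y : mor B X) (e : exE C X A)
          (A' B' X' : C) (x' : mor A' B') (y' : mor B' X') (e' : exE C X' A')
          (a : mor A A') (b : mor B B') (c : mor X X'),
        xi A B X x y e -> finite_Gpdim xi A -> finite_Gpdim xi X ->
        xi A' B' X' x' y' e' -> finite_Gpdim xi A' -> finite_Gpdim xi X' ->
        triangle_morphism x y e x' y' e' a b c ->
        forall (N : C) (n : int) (t : cxt R n A' N),
        dt A B X x y e N n (cxt_mapl R n a N t) =
        cxt_mapl R (n + 1) c N (dt A' B' X' x' y' e' N n t) &
      (* compatibility with the comparison maps, for every horseshoe diagram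
         computing the connecting map and all complete resolutions *)
      forall (A B X : C) (x : mor A B) (y : mor B X) (e : exE C X A),
        xi A B X x y e -> finite_Gpdim xi A -> finite_Gpdim xi X ->
        forall (H : horseshoe x y (R A) (R X))
            (TA : complete_resolution (R A)) (TX : complete_resolution (R X))
            (N : C) (n : int) (t : xt R n A N),
        dt A B X x y e N n (comparison_map (R N) TA t) =
        comparison_map (R N) TX (ext_connecting H t)].
Proof.
pose c A B X x y e :=
  cid (@connecting_cocycle_exists C xi A B X x y e (R A) (R X)).
have c_ext A B X (x : mor A B) (y : mor B X) e : xi A B X x y e ->
    ext_cocycle x y (sval (c A B X x y e)) := (svalP (c A B X x y e)).2.
exists (fun A B X x y e N n => splice (R N) n (svalP (c A B X x y e)).1); split.
- by move=> A B X x y e hx _ _ N n; apply: (cxt_long_exact hx); exact: c_ext.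
- move=> A B X x y e hx _ _ N N' g n b; have [q hq] := represents_surj b.
  set ht := (svalP (c A B X x y e)).1.
  pose u := res_lift g (R N) (R N').
  have h := represents_splice ht (represents_postcomp u hq).
  have h' := represents_postcomp u (represents_splice ht hq).
  apply/(represents_eq h h').
  rewrite (@hcompA _ _ _ _ _ 0 n 1 n (n + 1)) ?add0r // subrr.
  exact: null0.
- move=> A B X x y e A' B' X' x' y' e' a b f hx _ _ hx' _ _ [hab hbf _] N n t.
  have [q hq] := represents_surj t.
  have h := represents_splice (svalP (c A B X x y e)).1
    (represents_precomp (res_lift a (R A) (R A')) hq).
  have h' := represents_precomp (res_lift f (R X) (R X'))
    (represents_splice (svalP (c A' B' X' x' y' e')).1 hq).
  apply/(represents_eq h h').
  have [k hk] := ext_cocycle_natural hx' hab hbf (c_ext _ _ _ _ _ _ hx)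
    (c_ext _ _ _ _ _ _ hx') (res_lift_lift a (R A) (R A'))
    (res_lift_lift f (R X) (R X')).
  rewrite (@hcompA _ _ _ _ _ n 0 1 n 1) ?addr0 //.
  rewrite (@hcompA _ _ _ _ _ n 1 0 (n + 1) 1) ?addr0 // -raddfB /= -hk.
  by apply: null_hcompr => //; exact: represents_cod hq.
- move=> A B X x y e hx _ _ H TA TX N n t; apply: splice_comparison (hx) _.
  exact: c_ext.
Qed.
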